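(* Let $\tau:\mathbb{T}\to\mathbb{T}$ be an ergodic measure-preserving transformation on $(\mathbb{T},m)$. Let $A_1,A_2$ be two disjoint Borel subsets of $[0,1)$ such that $A_1\cup A_2=[0,1)$ and $m(A_k)>0$ for $k=1,2$. Let $\varphi_1$ and $\varphi_2$ be two nonconstant entire functions of exponential type. Consider the map $T(\omega):=\varphi_1(D)$ if $\omega\in A_1$, $T(\omega):=\varphi_2(D)$ if $\omega\in A_2$. Suppose that there exist $z,w\in\mathbb{C}$ such that $$|\varphi_1(z)|^{m(A_1)}\,|\varphi_2(z)|^{m(A_2)}<1\quad\text{and}\quad |\varphi_1(w)|^{m(A_1)}\,|\varphi_2(w)|^{m(A_2)}>1.$$ Then the random sequence $(T_n(\cdot))_{n\ge1}$ is topologically mixing, i.e. $(T_n(\omega))_{n\ge1}$ is topologically mixing on $H(\mathbb{C})$ for almost every $\omega\in\mathbb{T}$.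
   Context: $\mathbb{T}=\mathbb{R}/\mathbb{Z}$, identified with $[0,1)$, is equipped with its Borel sets and the normalized Lebesgue measure $m$. A Borel map $\tau:\mathbb{T}\to\mathbb{T}$ is measure-preserving if $m(\tau^{-1}(B))=m(B)$ for every Borel $B$, and ergodic if moreover $\tau^{-1}(B)=B$ implies $m(B)\in\{0,1\}$. For $\omega\in\mathbb{T}$ and $n\ge1$, $T_n(\omega):=T(\tau^{n-1}\omega)\cdots T(\tau\omega)T(\omega)$. A sequence $(S_n)_{n\ge1}$ of continuous maps on a space $X$ is topologically mixing if for all nonempty open $U,V\subset X$ one has $S_n(U)\cap V\neq\emptyset$ for all sufficiently large $n$. $H(\mathbb{C})$ is the Fréchet space of entire functions with the topology of uniform convergence on compact sets, and $D:f\mapsto f'$ the derivation operator on it. An entire function $\varphi$ is of exponential type if there are $M,A>0$ with $|\varphi(z)|\le Me^{A|z|}$ for all $z\in\mathbb{C}$; if $\varphi(z)=\sum_{n\ge0}a_nz^n$, then $\varphi(D):=\sum_{n\ge0}a_nD^n$, which is a continuous linear operator on $H(\mathbb{C})$. *)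

(* Defs.v *)
From HB Require Import structures.
From mathcomp Require Import all_boot all_order all_algebra.
From mathcomp Require Export complex.
From mathcomp Require Import all_classical all_reals all_analysis.
Set Implicit Arguments.
Unset Strict Implicit.
Unset Printing Implicit Defensive.
Import Order.TTheory GRing.Theory Num.Theory.
Import numFieldNormedType.Exports.
Local Open Scope classical_set_scope.
Local Open Scope ring_scope.

(* [R : realType] is the field of real numbers and [R[i]] the field of complex
   numbers.  As the library does for its own number types, [R[i]] is given the
   normed-module structure of [R[i]^o] over itself, for the norm [`|z|]; hence
   [derivable f z 1] is complex differentiability at [z] and [derive1n n f] is the
   n-th complex derivative. *)
#[export, non_forgetful_inheritance]
HB.instance Definition _ (R : realType) :=
  PseudoPointedMetric.copy R[i] (R[i])^o.
#[export, non_forgetful_inheritance]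
HB.instance Definition _ (R : realType) := GRing.ComAlgebra.copy R[i] (R[i])^o.
#[export, non_forgetful_inheritance]
HB.instance Definition _ (R : realType) := Vector.copy R[i] (R[i])^o.
#[export, non_forgetful_inheritance]
HB.instance Definition _ (R : realType) := NormedModule.copy R[i] (R[i])^o.
HB.instance Definition _ (R : realType) := Num.ClosedField.on R[i].

Definition is_entire (R : realType) (f : R[i] -> R[i]) : Prop :=
  forall z : R[i], derivable f z 1.

(* H(C): the set_type of entire functions, with the subspace topology induced
   by uniform convergence on compact sets. *)
Definition entire (R : realType) : Type :=
  set_type ([set f | is_entire f] : set {family compact, R[i] -> R[i]}).

HB.instance Definition _ (R : realType) := Uniform.on (entire R).

Definition entire_val (R : realType) (f : entire R) : R[i] -> R[i] := set_val f.
Coercion entire_val : entire >-> Funclass.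

Lemma is_entire0 (R : realType) : is_entire (fun=> 0 : R[i]).
Proof. by move=> z; exact: derivable_cst. Qed.

Definition entire0 (R : realType) : entire R :=
  SigSub (mem_set (@is_entire0 R)
    : (fun=> 0 : R[i]) \in
        ([set f | is_entire f] : set {family compact, R[i] -> R[i]})).

HB.instance Definition _ (R : realType) := isPointed.Build (entire R) (entire0 R).

Definition exponential_type (R : realType) (phi : R[i] -> R[i]) : Prop :=
  exists M A : R, [/\ 0 < M, 0 < A &
    forall z, Normc.normc (phi z) <= M * expR (A * Normc.normc z)].

Definition nonconstant (R : realType) (phi : R[i] -> R[i]) : Prop :=
  ~ exists c, forall z, phi z = c.

(* The coefficient a_n = phi^(n)(0) / n! of phi(z) = \sum_n a_n z^n. *)
Definition taylor_coef (R : realType) (phi : R[i] -> R[i]) (n : nat) : R[i] :=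
  derive1n n phi 0 / n`!%:R.

(* phi(D) f is the sum in H(C) of the series \sum_n a_n D^n f: the (unique)
   entire function to which the partial sums converge uniformly on compact
   sets.  When phi has exponential type, the series converges for every f, so
   that the default value of [get] plays no role. *)
Definition op_phiD (R : realType) (phi : R[i] -> R[i]) (f : entire R)
    : entire R :=
  get [set g : entire R | {family compact,
    (fun N z => \sum_(n < N) taylor_coef phi n * derive1n n f z) @ \oo --> (g : R[i] -> R[i])}].

(* T_n(w) = T(tau^{n-1} w) \o ... \o T(tau w) \o T(w) *)
Fixpoint cocycle (Omega X : Type) (tau : Omega -> Omega)
    (T : Omega -> X -> X) (n : nat) (w : Omega) : X -> X :=
  if n is n'.+1 then T (iter n' tau w) \o cocycle tau T n' w else id.

Definition topologically_mixing (X : topologicalType) (S : nat -> X -> X) :=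
  forall U V : set X, open U -> open V -> U !=set0 -> V !=set0 ->
    \forall n \near \oo, (S n @` U) `&` V !=set0.

(* The circle R/Z is identified with [0, 1), on which m is Lebesgue measure;
   a self-map of the circle is a map on R that preserves [0, 1), whose values
   outside [0, 1) are irrelevant. *)
Definition circle (R : realType) : set R := `[0, 1[.
Arguments circle : clear implicits.

Definition measure_preserving (R : realType) (tau : R -> R) : Prop :=
  [/\ (forall w, circle R w -> circle R (tau w)),
      measurable_fun (circle R) tau &
      forall B : set R, measurable B -> B `<=` circle R ->
        lebesgue_measure (circle R `&` tau @^-1` B) = lebesgue_measure B].

Definition ergodic (R : realType) (tau : R -> R) : Prop :=
  measure_preserving tau /\
  forall B : set R, measurable B -> B `<=` circle R ->
    circle R `&` tau @^-1` B = B ->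
    lebesgue_measure B = 0%E \/ lebesgue_measure B = 1%E.

(* Main.v *)
Require Import Defs.
From mathcomp Require Import all_boot all_order all_algebra.
From mathcomp Require Import complex.
From mathcomp Require Import ring lra.
From mathcomp Require Import all_classical all_reals all_analysis.
From mathcomp Require Import measurable_realfun.
Import Order.TTheory GRing.Theory Num.Theory.
Import numFieldNormedType.Exports.
Set Implicit Arguments.
Unset Strict Implicit.
Unset Printing Implicit Defensive.
Local Open Scope classical_set_scope.
Local Open Scope ring_scope.

(* The exponentials [z |-> e^(l z)] are common eigenvectors of all the operators
   phi(D), with eigenvalue phi(l); hence T_n(w) multiplies [e^(l z)] by
   phi1(l)^k phi2(l)^(n-k), where k counts the visits of w, .., tau^(n-1) w to A1.
   By ergodicity k/n tends to m(A1) for almost every w, so this factor decays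
   exponentially for l near the contracting point and grows exponentially for l
   near the expanding one.  Exponentials with frequencies in a given disc span a
   dense subspace of H(C).  So if u = sum c_i e^(l_i z) is in U with contracting
   frequencies and v = sum d_j e^(m_j z) is in V with expanding ones, then adding to
   u the (small) preimage under T_n(w) of v gives a point of U whose image is
   close to v.

   Only upper bounds on the numbers of visits to A1 and to A2 are needed, and they
   follow from the Katznelson-Weiss covering argument.

   Entire functions being merely complex differentiable, their Taylor expansion
   has to be established first.  In the coordinate w = e^z circles become vertical
   segments, and for a 2 i pi-periodic function Goursat's theorem on a rectangle
   says that the integral over such a segment does not depend on its abscissa.
   Applied to f(w) w^-n this defines the Laurent coefficients; applied to
   w (f(w) - f(w0)) / (w - w0), whose integral tends to 0 with the radius, it gives
   Cauchy's formula. *)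

(** Convergence of power series is recorded with an explicit error [C / 2 ^+ N]. A bound
    [nc (a n) * (2 * r) ^+ n <= C] on the coefficients gives it on the disc of radius [r], doubling
    the radius being what produces the factor [2 ^- n]; uniform convergence on compact sets becomes
    a family of inequalities on closed discs.

    The hypotheses on [z] and [w] concern single points, but they are strict. This slack is spent
    twice: on a disc of frequencies around each point, which density requires, and on the error in
    the frequencies of visits.

    Density with frequencies near [l] rests on [(e^(h z) - 1) / h], which tends to [z]: multiplying
    an exponential sum by it moves the frequencies by at most [h]. Hence [z^k e^(l z)] is a limit of
    exponential sums, and the Taylor expansion of [f(z) e^(- l z)] reaches every entire [f].

    The operators are evaluated on finite exponential sums only, where the series defining [phi(D)]
    is summed explicitly. *)

Local Notation nc := Normc.normc.

(** * Complex numbers and complex differentiability *)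

Section ComplexPlane.
Variable R : realType.
Implicit Types z w : R[i].

(** The norm of [R[i]] is itself [R[i]]-valued, so the radius of a ball is a complex number; being
    positive, it has zero imaginary part, and real radii measured by [nc] define the same
    neighbourhoods. *)
Lemma nbhs_ncP z (U : set R[i]) :
  nbhs z U <-> exists2 e : R, 0 < e & forall y, nc (y - z) < e -> U y.
Proof.
rewrite -nbhs_ballE /nbhs_ball /nbhs_ball_ /=; split => [[[e e'] /= + h]|[e e0 h]].
  rewrite ltcE /= => /andP[/eqP e'0 e0]; exists e => // y yz; apply: h.
  rewrite /ball /= distrC -[`|_|]/((nc _)%:C)%C.
  by rewrite e'0 complexr0 ltcR.
exists (e%:C)%C; first by rewrite /= ltcR.
move=> y; rewrite /ball /= distrC -[`|_|]/((nc _)%:C)%C ltcR; exact: h.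
Qed.

Lemma ncN z : nc (- z) = nc z. Proof. exact: normcN. Qed.
Lemma ncB z w : nc (z - w) = nc (w - z). Proof. by rewrite -ncN opprB. Qed.
Lemma ncM z w : nc (z * w) = nc z * nc w. Proof. exact: Normc.normcM. Qed.
Lemma ncV z : nc z^-1 = (nc z)^-1. Proof. exact: Normc.normcV. Qed.
Lemma nc0 : nc (0 : R[i]) = 0. Proof. exact: Normc.normc0. Qed.
Lemma nc1 : nc (1 : R[i]) = 1. Proof. exact: Normc.normc1. Qed.
Lemma ncX z n : nc (z ^+ n) = nc z ^+ n.
Proof. by elim: n => [|n IH]; rewrite ?expr0 ?nc1// !exprS ncM IH. Qed.
Lemma nc_ge0 z : 0 <= nc z. Proof. by case: z => a b; exact: sqrtr_ge0. Qed.
Lemma nc_eq0 z : (nc z == 0) = (z == 0).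
Proof. by apply/eqP/eqP => [/Normc.eq0_normc//|->]; rewrite nc0. Qed.
Lemma nc_gt0 z : (0 < nc z) = (z != 0).
Proof. by rewrite lt_def nc_ge0 nc_eq0 andbT. Qed.
Lemma ncD z w : nc (z + w) <= nc z + nc w. Proof. exact: le_normcD. Qed.
Lemma ncDB z w : nc z <= nc w + nc (z - w).
Proof. by rewrite -{1}(subrK w z) addrC ncD. Qed.
Lemma nc_real (x : R) : nc (x%:C)%C = `|x|.
Proof. by rewrite /= expr0n /= addr0 sqrtr_sqr. Qed.
Lemma nc_i : nc ('i%C : R[i]) = 1.
Proof. by rewrite /= expr0n /= add0r expr1n sqrtr1. Qed.
Lemma nc_nat n : nc (n%:R : R[i]) = n%:R.
Proof. by rewrite -(rmorph_nat (real_complex R)) nc_real ger0_norm. Qed.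
Lemma Re_le_nc z : `|complex.Re z| <= nc z.
Proof. by case: z => a b /=; rewrite -sqrtr_sqr ler_wsqrtr// lerDl sqr_ge0. Qed.
Lemma Im_le_nc z : `|complex.Im z| <= nc z.
Proof. by case: z => a b /=; rewrite -sqrtr_sqr ler_wsqrtr// lerDr sqr_ge0. Qed.
Lemma nc_le z : nc z <= `|complex.Re z| + `|complex.Im z|.
Proof.
case: z => a b /=; rewrite -(ler_pXn2r (ltn0Sn 1)) ?nnegrE ?addr_ge0// ?sqrtr_ge0//.
rewrite sqr_sqrtr ?addr_ge0 ?sqr_ge0// sqrrD !real_normK ?num_real//.
by rewrite lerD2r lerDl mulrn_wge0// mulr_ge0.
Qed.

Lemma nc_sum (I : Type) (s : seq I) (F : I -> R[i]) :
  nc (\sum_(i <- s) F i) <= \sum_(i <- s) nc (F i).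
Proof.
elim: s => [|i s IH]; first by rewrite !big_nil nc0.
by rewrite !big_cons (le_trans (ncD _ _)) // lerD2l.
Qed.

Lemma RecD z w : complex.Re (z + w) = complex.Re z + complex.Re w.
Proof. by case: z w => a b [c d]. Qed.
Lemma ImcD z w : complex.Im (z + w) = complex.Im z + complex.Im w.
Proof. by case: z w => a b [c d]. Qed.
Lemma RecN z : complex.Re (- z) = - complex.Re z.
Proof. by case: z => a b. Qed.
Lemma ImcN z : complex.Im (- z) = - complex.Im z.
Proof. by case: z => a b. Qed.
Lemma RecM z w : complex.Re (z * w) =
  complex.Re z * complex.Re w - complex.Im z * complex.Im w.
Proof. by case: z w => a b [c d]. Qed.
Lemma ImcM z w : complex.Im (z * w) =
  complex.Re z * complex.Im w + complex.Im z * complex.Re w.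
Proof. by case: z w => a b [c d]. Qed.

Section Continuity.
Variable X : topologicalType.
Implicit Types (f g : X -> R[i]) (x : X).

(* Sealing continuity keeps the unifier from looking for the topology of [R[i]]
   through its several structures. *)
Variant contC (f : X -> R[i]) (x : X) : Prop := ContC of {for x, continuous f}.

Lemma contCP f x : contC f x <->
  forall e : R, 0 < e -> \forall y \near x, nc (f y - f x) < e.
Proof.
split=> [[h] e e0|h].
  by apply: (h [set z | nc (z - f x) < e]); apply/nbhs_ncP; exists e.
split=> U /= /nbhs_ncP[e e0 H]; near=> y; apply: H; near: y; exact: h.
Unshelve. all: by end_near. Qed.

Lemma contCD f g x : contC f x -> contC g x -> contC (fun y => f y + g y) x.
Proof. move=> [hf] [hg]; split; exact: (cvgD hf hg). Qed.

Lemma contCM f g x : contC f x -> contC g x -> contC (fun y => f y * g y) x.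
Proof. move=> [hf] [hg]; split; exact: (cvgM hf hg). Qed.

Lemma contCN f x : contC f x -> contC (fun y => - f y) x.
Proof. move=> [hf]; split; exact: (cvgN hf). Qed.

Lemma contCB f g x : contC f x -> contC g x ->
  contC (fun y => f y - g y) x.
Proof. move=> [hf] [hg]; split; exact: (cvgB hf hg). Qed.

Lemma contCV f x : f x != 0 -> contC f x ->
  contC (fun y => (f y)^-1) x.
Proof. move=> f0 [hf]; split; exact: (cvgV f0 hf). Qed.

Lemma contCst (c : R[i]) x : contC (fun _ : X => c) x.
Proof. by apply/contCP => e e0; near=> y; rewrite subrr nc0.
Unshelve. all: by end_near. Qed.

Lemma contCX f n x : contC f x -> contC (fun y => f y ^+ n) x.
Proof.
move=> hf; elim: n => [|n IH]; first exact: contCst.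
rewrite (_ : (fun y => _) = fun y => f y * f y ^+ n); first exact: contCM.
by apply/funext => y; rewrite exprS.
Qed.

Lemma contCsum (I : Type) (s : seq I) (F : I -> X -> R[i]) x :
  (forall i, contC (F i) x) ->
  contC (fun y => \sum_(i <- s) F i y) x.
Proof.
move=> h; elim: s => [|i s IH].
  by rewrite (_ : (fun y => _) = fun=> 0); [exact: contCst|apply/funext => y; rewrite big_nil].
rewrite (_ : (fun y => _) = fun y => F i y + \sum_(i <- s) F i y).
  exact: (contCD (h i) IH).
by apply/funext => y; rewrite big_cons.
Qed.

Lemma contC_continuous f x : contC f x -> {for x, continuous f}.
Proof. by case. Qed.

Lemma contRe f x : contC f x -> {for x, continuous (fun y => complex.Re (f y))}.
Proof.
move=> /contCP h; apply/cvgrPdist_lt => e /h; apply: filterS => y; apply: le_lt_trans.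
by rewrite distrC -RecN -RecD Re_le_nc.
Qed.

Lemma contIm f x : contC f x -> {for x, continuous (fun y => complex.Im (f y))}.
Proof.
move=> /contCP h; apply/cvgrPdist_lt => e /h; apply: filterS => y; apply: le_lt_trans.
by rewrite distrC -ImcN -ImcD Im_le_nc.
Qed.

Lemma contCpair (a b : X -> R) x : {for x, continuous a} -> {for x, continuous b} ->
  contC (fun y => (a y +i* b y)%C) x.
Proof.
move=> /cvgrPdist_lt ha /cvgrPdist_lt hb; apply/contCP => e e0.
have e2 : 0 < e / 2 by rewrite divr_gt0.
near=> y; apply: le_lt_trans (nc_le _) _.
rewrite [ltRHS]splitr ltrD//= distrC; near: y; [exact: ha|exact: hb].
Unshelve. all: by end_near. Qed.

End Continuity.

Lemma contCcomp (X Y : topologicalType) (f : X -> Y) (g : Y -> R[i]) x :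
  {for x, continuous f} -> contC g (f x) ->
  contC (fun y => g (f y)) x.
Proof. by move=> hf [hg]; split; exact: (continuous_comp hf hg). Qed.

Lemma contCid z : contC (fun w : R[i] => w) z.
Proof. split; exact: cvg_id. Qed.

(* Carathéodory's form of complex differentiability: it turns the product,
   quotient and chain rules into statements about continuity. *)
Definition diffC (f : R[i] -> R[i]) z l :=
  exists q : R[i] -> R[i], [/\ contC q z, q z = l
    & forall w, f w - f z = q w * (w - z)].

Lemma diffC_cont f z l : diffC f z l -> contC f z.
Proof.
move=> [q [cq _ e]]; have -> : f = fun w => q w * (w - z) + f z.
  by apply/funext => w; rewrite -e subrK.
apply: contCD; last exact: contCst.
by apply: contCM => //; apply: contCB; [exact: contCid|exact: contCst].
Qed.

Lemma diffC_cst c z : diffC (fun=> c) z 0.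
Proof. by exists (fun=> 0); split=> [|//|w]; rewrite ?subrr ?mul0r//; exact: contCst. Qed.

Lemma diffC_id z : diffC (fun w => w) z 1.
Proof. by exists (fun=> 1); split=> [|//|w]; rewrite ?mul1r//; exact: contCst. Qed.

Lemma diffC_add f g z l m : diffC f z l -> diffC g z m ->
  diffC (fun w => f w + g w) z (l + m).
Proof.
move=> [p [cp <- ep]] [q [cq <- eq]]; exists (fun w => p w + q w); split => //.
  exact: contCD.
by move=> w; rewrite mulrDl -ep -eq opprD addrACA.
Qed.

Lemma diffC_mul f g z l m : diffC f z l -> diffC g z m ->
  diffC (fun w => f w * g w) z (l * g z + f z * m).
Proof.
move=> df dg; have cg := diffC_cont dg.
case: df dg => [p [cp <- ep]] [q [cq <- eq]].
exists (fun w => p w * g w + f z * q w); split => //.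
  by apply: contCD; apply: contCM => //; exact: contCst.
by move=> w; rewrite mulrDl mulrAC -ep -mulrA -eq; ring.
Qed.

Lemma diffC_opp f z l : diffC f z l -> diffC (fun w => - f w) z (- l).
Proof.
move=> [p [cp <- ep]]; exists (fun w => - p w); split => //; first exact: contCN.
by move=> w; rewrite mulNr -ep opprB opprK addrC.
Qed.

Lemma diffC_sub f g z l m : diffC f z l -> diffC g z m ->
  diffC (fun w => f w - g w) z (l - m).
Proof. by move=> df dg; apply: (diffC_add df); exact: diffC_opp. Qed.

Lemma diffC_comp f g z l m : diffC f z l -> diffC g (f z) m ->
  diffC (fun w => g (f w)) z (m * l).
Proof.
move=> df; have cf := diffC_cont df; case: df => [p [cp <- ep]] [q [cq <- eq]].
exists (fun w => q (f w) * p w); split => //.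
  by apply: contCM => //; exact: (contCcomp (contC_continuous cf) cq).
by move=> w; rewrite -mulrA -ep -eq.
Qed.

End ComplexPlane.

(** * Entire functions and the complex derivative *)

Section Entire.
Variable R : realType.
Implicit Types z w : R[i].

Lemma dnbhs_ncP0 (U : set R[i]) :
  nbhs (0 : R[i])^' U <-> exists2 e : R, 0 < e & forall y, y != 0 -> nc y < e -> U y.
Proof.
rewrite /dnbhs /within /=; split=> [/nbhs_ncP[e e0 h]|[e e0 h]].
  by exists e => // y y0 ye; apply: h => //; rewrite subr0.
by apply/nbhs_ncP; exists e => // y; rewrite subr0 => ye y0; apply: h.
Qed.

Lemma diffC_cvg (f : R[i] -> R[i]) z l : diffC f z l <->
  (fun h => h^-1 *: ((f \o shift z) (h *: 1) - f z)) @ (0 : R[i])^' --> l.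
Proof.
split=> [[q [[cq] <- e]]|h].
  move=> U /= /cq/nbhs_ncP[d d0 hd]; apply/dnbhs_ncP0; exists d => // h h0 hd'.
  rewrite /= {1}/GRing.scale /= /GRing.scale/= mulr1 e addrK mulrC mulfK//.
  by apply: hd; rewrite addrK.
exists (fun w => if w == z then l else (f w - f z) / (w - z)); split.
- split=> U; rewrite /= eqxx => Ul; have := h U Ul => /dnbhs_ncP0[d d0 hd].
  apply/nbhs_ncP; exists d => // w wd /=.
  case: eqP => [_|/eqP wz]; first exact: nbhs_singleton.
  have /= := hd (w - z); rewrite /GRing.scale/= /GRing.scale/= mulr1 subrK mulrC; apply => //.
  by rewrite subr_eq0.
- by rewrite eqxx.
- move=> w; case: eqP => [->|/eqP wz]; first by rewrite !subrr mulr0.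
  by rewrite divfK// subr_eq0.
Qed.

Lemma diffC_derivable (f : R[i] -> R[i]) z l : diffC f z l -> derivable f z 1.
Proof. by move=> /diffC_cvg h; apply/cvg_ex; exists l. Qed.

Lemma diffC_derive1 (f : R[i] -> R[i]) z l : diffC f z l -> derive1 f z = l.
Proof.
move=> /diffC_cvg h; rewrite derive1E; apply/cvg_lim => //; exact: norm_hausdorff.
Qed.

Lemma is_entireP (f : R[i] -> R[i]) : is_entire f <-> forall z, diffC f z (derive1 f z).
Proof.
split=> [h z|h z]; last exact: diffC_derivable (h z).
apply/diffC_cvg; rewrite derive1E; exact: (h z).
Qed.

Lemma is_entireW (f g : R[i] -> R[i]) : (forall z, diffC f z (g z)) -> is_entire f.
Proof. by move=> h z; exact: diffC_derivable (h z). Qed.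

Lemma derive1_entire (f g : R[i] -> R[i]) : (forall z, diffC f z (g z)) -> derive1 f = g.
Proof. by move=> h; apply/funext => z; exact: diffC_derive1. Qed.

End Entire.

(** * The complex exponential *)

Section RealBounds.
Variable R : realType.
Implicit Types x y : R.

Lemma sin_mvt y : 0 <= y -> exists2 c, 0 <= c <= y & sin y = cos c * y.
Proof.
move=> y0; have [|c + e] := @MVT_segment R sin cos 0 y y0.
  by apply: continuous_subspaceT; exact: continuous_sin.
by rewrite in_itv/= => cy; move: e; rewrite sin0 !subr0 => e; exists c.
Qed.

Lemma norm_sin_le y : `|sin y| <= `|y|.
Proof.
wlog y0 : y / 0 <= y => [h|].
  have [/h//|/ltW y0] := leP 0 y.
  by have := h (- y); rewrite oppr_ge0 sinN !normrN; exact.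
have [c _ ->] := sin_mvt y0; rewrite normrM ler_piMl//; exact: cos_max.
Qed.

Lemma cos_half y : cos y = 1 - 2 * sin (y / 2) ^+ 2.
Proof.
have -> : cos y = cos ((y / 2) *+ 2) by congr cos; field.
by rewrite cos_mulr2n cos2sin2; ring.
Qed.

Lemma norm_cosB1_le y : `|cos y - 1| <= y ^+ 2.
Proof.
rewrite cos_half addrAC subrr sub0r normrN normrM ger0_norm// normrX.
have := norm_sin_le (y / 2); rewrite normrM [`|2^-1|]ger0_norm// => h.
have : `|sin (y / 2)| ^+ 2 <= (`|y| / 2) ^+ 2 by rewrite lerXn2r// ?nnegrE ?mulr_ge0.
by rewrite exprMn !real_normK ?num_real// => h2; have := sqr_ge0 y; rewrite expr2 in h2 *; lra.
Qed.

Lemma norm_sinB_le y : `|y| <= 1 -> `|sin y - y| <= y ^+ 2.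
Proof.
wlog y0 : y / 0 <= y => [h|].
  have [/h//|/ltW y0] := leP 0 y.
  move=> y1; have := h (- y); rewrite oppr_ge0 normrN sqrrN => /(_ y0 y1).
  by rewrite sinN -opprD normrN.
move=> y1; have [c /andP[c0 cy] ->] := sin_mvt y0.
rewrite -{2}[y]mul1r -mulrBl normrM (ger0_norm y0) (le_trans (ler_wpM2r y0 (norm_cosB1_le c)))//.
rewrite [y ^+ 2]expr2 ler_wpM2r// expr2 (le_trans (ler_wpM2l c0 cy))//.
by rewrite ger0_norm// in y1; rewrite ler_piMl// (le_trans cy).
Qed.

(** The lower bound is [1 + x <= e^x]; the upper one is the same inequality at [- x], in the form
    [e^x (1 - x) <= 1]. *)
Lemma norm_expRB1D_le x : `|x| <= 1 / 2 -> `|expR x - 1 - x| <= 2 * x ^+ 2.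
Proof.
rewrite ler_norml => /andP[xl xr].
have h1 := expR_ge1Dx x; have h2 := expR_ge1Dx (- x).
rewrite ger0_norm; last by lra.
have e0 := expR_gt0 x.
have : expR x * (1 - x) <= 1.
  by rewrite (@le_trans _ _ (expR x * expR (- x)))// ?ler_pM2l// -expRD subrr expR0.
have := sqr_ge0 x; rewrite expr2; nra.
Qed.

Lemma norm_expRB1_le x : `|x| <= 1 / 2 -> `|expR x - 1| <= 2 * `|x|.
Proof.
move=> x2; have := norm_expRB1D_le x2.
rewrite -{2}[expR x - 1](subrK x) => h; rewrite (le_trans (ler_normD _ _))// -lerBrDr (le_trans h)//.
rewrite -(real_normK (num_real x)) expr2; have := normr_ge0 x; nra.
Qed.

End RealBounds.

Section ComplexExp.
Variable R : realType.
Implicit Types z w h : R[i].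

Definition cexp z : R[i] :=
  ((expR (complex.Re z) * cos (complex.Im z)) +i*
   (expR (complex.Re z) * sin (complex.Im z)))%C.

Lemma cexpD z w : cexp (z + w) = cexp z * cexp w.
Proof.
case: z w => a b [c d]; rewrite /cexp /= expRD cosD sinD.
by apply/eqP; rewrite eq_complex /=; apply/andP; split; apply/eqP; ring.
Qed.

Lemma cexp0 : cexp 0 = 1.
Proof. by rewrite /cexp /= expR0 cos0 sin0 mulr1 mulr0. Qed.

Lemma nc_cexp z : nc (cexp z) = expR (complex.Re z).
Proof.
case: z => a b; rewrite /cexp /= !exprMn -mulrDr cos2Dsin2 mulr1 sqrtr_sqr.
by rewrite ger0_norm// expR_ge0.
Qed.

Lemma cexp_neq0 z : cexp z != 0.
Proof. by rewrite -nc_gt0 nc_cexp expR_gt0. Qed.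

Lemma cexpN z : cexp (- z) = (cexp z)^-1.
Proof.
by apply: (mulIf (cexp_neq0 z)); rewrite -cexpD addNr cexp0 mulVf// cexp_neq0.
Qed.

Lemma cexpMn z n : cexp (n%:R * z) = cexp z ^+ n.
Proof.
elim: n => [|n IH]; first by rewrite mul0r cexp0 expr0.
by rewrite exprS -IH -cexpD -natr1 mulrDl mul1r addrC.
Qed.

(** The real and the imaginary part each contribute at most [4 * nc h ^+ 2]. This one estimate
    yields both the derivative of [cexp] and the error of the difference quotients used for
    density. *)
Lemma nc_cexpB1D_le h : nc h <= 1 / 2 -> nc (cexp h - 1 - h) <= 9 * nc h ^+ 2.
Proof.
move=> h2; have hx := le_trans (Re_le_nc h) h2; have hy := le_trans (Im_le_nc h) h2.
have x2 : `|complex.Re h| ^+ 2 <= nc h ^+ 2 by rewrite lerXn2r ?nnegrE ?nc_ge0 ?Re_le_nc.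
have y2 : `|complex.Im h| ^+ 2 <= nc h ^+ 2 by rewrite lerXn2r ?nnegrE ?nc_ge0 ?Im_le_nc.
have xy : `|complex.Re h| * `|complex.Im h| <= nc h ^+ 2.
  by rewrite expr2 ler_pM ?Re_le_nc ?Im_le_nc.
have e2 : expR (complex.Re h) <= 2.
  have := norm_expRB1_le hx; rewrite ler_norml => /andP[_]; lra.
rewrite real_normK ?num_real// in x2; rewrite real_normK ?num_real// in y2.
rewrite (le_trans (nc_le _))// !RecD !ImcD !RecN !ImcN /= subr0.
set x := complex.Re h in hx x2 xy e2 *; set y := complex.Im h in hy y2 xy *.
have re : `|expR x * cos y - 1 - x| <= 4 * nc h ^+ 2.
  have -> : expR x * cos y - 1 - x = expR x * (cos y - 1) + (expR x - 1 - x) by ring.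
  rewrite (le_trans (ler_normD _ _))// normrM (ger0_norm (expR_ge0 _)).
  have a1 := norm_cosB1_le y; have a2 := norm_expRB1D_le hx.
  have : expR x * `|cos y - 1| <= 2 * y ^+ 2 by rewrite ler_pM// expR_ge0.
  lra.
have im : `|expR x * sin y - y| <= 4 * nc h ^+ 2.
  have -> : expR x * sin y - y = expR x * (sin y - y) + (expR x - 1) * y by ring.
  rewrite (le_trans (ler_normD _ _))// !normrM (ger0_norm (expR_ge0 _)).
  have y1 : `|y| <= 1 by lra.
  have a1 := norm_sinB_le y1; have a2 := norm_expRB1_le hx.
  have : expR x * `|sin y - y| <= 2 * y ^+ 2 by rewrite ler_pM// expR_ge0.
  have : `|expR x - 1| * `|y| <= 2 * `|x| * `|y| by rewrite ler_wpM2r.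
  lra.
have := sqr_ge0 (nc h); lra.
Qed.

Lemma diffC_cexp z : diffC cexp z (cexp z).
Proof.
exists (fun w => cexp z * (if w == z then 1 else (cexp (w - z) - 1) / (w - z))); split.
- apply: contCM; first exact: contCst.
  apply/contCP => e e0; apply/nbhs_ncP; exists (Num.min (1 / 2) (e / 9)).
    by rewrite lt_min !divr_gt0.
  move=> w; rewrite lt_min eqxx => /andP[w1 w2].
  case: eqP => [_|/eqP wz]; first by rewrite subrr nc0.
  have d0 : w - z != 0 by rewrite subr_eq0.
  have -> : (cexp (w - z) - 1) / (w - z) - 1 = (cexp (w - z) - 1 - (w - z)) / (w - z).
    by rewrite [RHS]mulrBl mulfV.
  rewrite ncM ncV ltr_pdivrMr ?nc_gt0// (le_lt_trans (nc_cexpB1D_le (ltW w1)))//.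
  by rewrite expr2 mulrA ltr_pM2r ?nc_gt0//; lra.
- by rewrite eqxx mulr1.
- move=> w; case: eqP => [->|/eqP wz]; first by rewrite !subrr mulr0.
  rewrite -mulrA divfK ?subr_eq0// mulrBr mulr1 -cexpD.
  by rewrite [z + _]addrC subrK.
Qed.

(** Comparing moduli gives equal real parts. The difference [t] of the imaginary parts has
    [cos t = 1], so [sin (t / 2) = 0] with [|t / 2| < pi], which forces [t = 0]. *)
Lemma cexp_inj z w : `|complex.Im z - complex.Im w| < pi *+ 2 -> cexp z = cexp w -> z = w.
Proof.
move=> hI e; have eRe : complex.Re z = complex.Re w.
  by apply: (@expR_inj R); rewrite -!nc_cexp e.
have e1 : cexp (z - w) = 1 by rewrite cexpD cexpN e mulfV// cexp_neq0.
have : complex.Re (cexp (z - w)) = 1 by rewrite e1.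
rewrite /= RecD RecN eRe subrr expR0 mul1r ImcD ImcN.
set t := (X in cos X = 1) => ct.
have s0 : sin (t / 2) = 0.
  have := cos_half t; rewrite ct => h.
  by apply/eqP; rewrite -sqrf_eq0; apply/eqP; lra.
have tpi : `|t / 2| < pi.
  by rewrite normrM [`|2^-1|]ger0_norm// ltr_pdivrMr// mulr_natr.
have t0 : t = 0.
  case: (ltrgtP 0 t) => // ht.
    suff: 0 < sin (t / 2) by rewrite s0 ltxx.
    by apply: sin_gt0_pi; rewrite divr_gt0//= (le_lt_trans (ler_norm _)).
  suff: 0 < sin (- (t / 2)) by rewrite sinN s0 oppr0 ltxx.
  apply: sin_gt0_pi; rewrite oppr_gt0 pmulr_llt0// ht/=.
  by rewrite (le_lt_trans (ler_norm _))// normrN.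
move/eqP: t0; rewrite subr_eq0 => /eqP eIm.
by apply/eqP; rewrite eq_complex eRe eIm !eqxx.
Qed.

(** The hypothesis removes the half-line of nonpositive reals. What matters is the strict bound: it
    places the logarithm strictly between the horizontal sides, at heights [- pi] and [pi], of the
    rectangles used below. *)
Lemma cexp_log z : 0 < complex.Re z \/ complex.Im z != 0 ->
  exists2 w, cexp w = z & `|complex.Im w| < pi.
Proof.
move=> hz.
have r0 : 0 < nc z.
  rewrite nc_gt0; apply: contraPneq hz => ->; rewrite /= ltxx eqxx.
  by case.
have [s es] := expR_total r0.
pose x := complex.Re z / nc z.
have r2 : nc z ^+ 2 = complex.Re z ^+ 2 + complex.Im z ^+ 2.
  by case: (z) => a b /=; rewrite sqr_sqrtr// addr_ge0// sqr_ge0.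
have x1 : x <= 1 by rewrite ler_pdivrMr// mul1r (le_trans _ (Re_le_nc z))// ler_norm.
have xm1 : -1 < x.
  rewrite ltr_pdivlMr// mulN1r ltrNl.
  case: hz => [h|h]; first by rewrite (lt_trans _ r0)// oppr_lt0.
  have := Re_le_nc z; rewrite ler_norml => /andP[+ _]; rewrite le_eqVlt => /orP[/eqP e|].
    have : complex.Im z ^+ 2 = 0 by move: r2; rewrite -e sqrrN; lra.
    by move/eqP; rewrite sqrf_eq0 (negbTE h).
  by rewrite ltrNl.
have x11 : -1 <= x <= 1 by rewrite ltW.
have sa : sin (acos x) = `|complex.Im z| / nc z.
  rewrite sin_acos// -[RHS]ger0_norm ?divr_ge0// ?nc_ge0// -sqrtr_sqr; congr Num.sqrt.
  rewrite /x !exprMn real_normK ?num_real// exprVn.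
  have n0 : nc z ^+ 2 != 0 by rewrite expf_neq0 ?gt_eqF.
  by apply: (mulIf n0); rewrite mulrBl !divfK// mul1r r2 addrC addKr.
have ca : cos (acos x) = x by rewrite acosK// in_itv.
have ap : `|acos x| < pi by rewrite ger0_norm ?acos_ge0 ?acos_ltpi ?xm1.
have rK y : nc z * (y / nc z) = y by rewrite mulrC divfK// gt_eqF.
have [i0|i0] := leP 0 (complex.Im z).
  exists (s +i* acos x)%C => //; rewrite /cexp /= es ca sa ger0_norm// !rK.
  by case: (z).
exists (s +i* (- acos x))%C; last by rewrite /= normrN.
rewrite /cexp /= es cosN sinN ca sa ltr0_norm// mulNr opprK !rK.
by case: (z).
Qed.

End ComplexExp.

(** * Integrals of complex-valued functions *)

Section RealIntegral.
Variable R : realType.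
Implicit Types (a b m M : R) (g h : R -> R).

Definition rint a b g : R := \int[lebesgue_measure]_(x in `[a, b]) g x.

Lemma continuous_integrable a b g : continuous g ->
  (lebesgue_measure : measure _ R).-integrable `[a, b] (EFin \o g).
Proof.
move=> cg; apply: continuous_compact_integrable; first exact: segment_compact.
exact: continuous_subspaceT.
Qed.

Lemma eq_rint a b g h : (forall x, a <= x <= b -> g x = h x) -> rint a b g = rint a b h.
Proof. by move=> e; apply: eq_Rintegral => x; rewrite inE/= in_itv/= => /e. Qed.

Lemma rintD a b g h : continuous g -> continuous h ->
  rint a b (fun x => g x + h x) = rint a b g + rint a b h.
Proof. by move=> cg ch; apply: RintegralD => //; exact: continuous_integrable. Qed.

Lemma rintZ a b c g : continuous g -> rint a b (fun x => c * g x) = c * rint a b g.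
Proof. by move=> cg; apply: RintegralZl => //; exact: continuous_integrable. Qed.

Lemma rint_cst a b c : a <= b -> rint a b (fun=> c) = c * (b - a).
Proof.
move=> ab; rewrite /rint Rintegral_cst//= lebesgue_measure_itv/= lte_fin.
by move: ab; rewrite le_eqVlt => /orP[/eqP ->|->//]; rewrite ltxx subrr.
Qed.

Lemma rint_split a m b g : a <= m -> m <= b -> continuous g ->
  rint a b g = rint a m g + rint m b g.
Proof.
move=> am mb cg; rewrite /rint -(@Rintegral_itv_obnd_cbnd _ m).
  rewrite -(@Rintegral_itvB _ g (BLeft a) (BRight b) m) ?bnd_simp//; first by rewrite addrC subrK.
  exact: continuous_integrable.
apply: (integrableS _ _ _ (continuous_integrable m b cg)) => //.
exact: subset_itv_oc_cc.
Qed.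

Lemma rint_norm_le a b M g : a <= b -> continuous g ->
  (forall x, a <= x <= b -> `|g x| <= M) -> `|rint a b g| <= M * (b - a).
Proof.
move=> ab cg h; rewrite -(rint_cst M ab).
have ig := continuous_integrable a b cg.
apply: le_trans (le_normr_Rintegral _ ig) _ => //.
apply: le_Rintegral => //.
- exact: (integrable_norm ig).
- by apply: (@continuous_integrable a b (fun=> M)) => x; exact: cvg_cst.
Qed.

Lemma rint_id a b : a <= b -> rint a b id = (b ^+ 2 - a ^+ 2) / 2.
Proof.
rewrite le_eqVlt => /orP[/eqP ->|ab].
  by rewrite /rint set_itv1 Rintegral_set1 subrr mul0r.
have d (x : R) : is_derive x 1 (fun y : R => 2^-1 * (y * y)) x.
  have h := is_deriveM (is_derive_id x 1) (is_derive_id x 1).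
  have := is_deriveZ 2^-1 h.
  rewrite (_ : 2^-1 *: _ = x); last by rewrite /GRing.scale/= /GRing.scale/= !mulr1; field.
  exact.
have cF (x : R) : {for x, continuous (fun y : R => 2^-1 * (y * y))}.
  by apply: differentiable_continuous; apply/derivable1_diffP; apply: ex_derive.
rewrite /rint /Rintegral (@continuous_FTC2 _ _ (fun y : R => 2^-1 * (y * y)))//=.
- by field.
- by apply: continuous_subspaceT => x; exact: cvg_id.
- split.
  + by move=> x _; apply: ex_derive.
  + exact: cvg_at_right_filter (cF a).
  + exact: cvg_at_left_filter (cF b).
- by move=> x _; rewrite derive1E; apply: derive_val.
Qed.
End RealIntegral.

Section ComplexIntegral.
Variable R : realType.
Implicit Types (a b m M : R) (g h : R -> R[i]).

Definition cint a b g : R[i] :=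
  (rint a b (fun x => complex.Re (g x)) +i* rint a b (fun x => complex.Im (g x)))%C.

Lemma complex_ext (z w : R[i]) : complex.Re z = complex.Re w -> complex.Im z = complex.Im w -> z = w.
Proof. by case: z w => a b [c d] /= -> ->. Qed.

Lemma cRe g : (forall x, contC g x) -> continuous (fun x => complex.Re (g x)).
Proof. by move=> cg x; exact: contRe. Qed.

Lemma cIm g : (forall x, contC g x) -> continuous (fun x => complex.Im (g x)).
Proof. by move=> cg x; exact: contIm. Qed.

Lemma eq_cint a b g h : (forall x, a <= x <= b -> g x = h x) -> cint a b g = cint a b h.
Proof. by move=> e; apply: complex_ext; apply: eq_rint => x /e ->. Qed.

Lemma cintD a b g h : (forall x, contC g x) -> (forall x, contC h x) ->
  cint a b (fun x => g x + h x) = cint a b g + cint a b h.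
Proof.
move=> cg ch; apply: complex_ext => /=; rewrite -rintD; try (exact: cRe || exact: cIm).
  by apply: eq_rint => x _; rewrite RecD.
by apply: eq_rint => x _; rewrite ImcD.
Qed.

Lemma cintZ a b c g : (forall x, contC g x) ->
  cint a b (fun x => c * g x) = c * cint a b g.
Proof.
move=> cg.
have sc (k : R) (u : R -> R) : continuous u -> continuous (fun x => k * u x).
  by move=> cu x; apply: cvgM; [exact: cvg_cst|exact: cu].
have cr := cRe cg; have ci := cIm cg.
apply: complex_ext; [rewrite [RHS]RecM|rewrite [RHS]ImcM] => /=.
  rewrite -mulNr -!rintZ// -rintD; [|exact: sc..].
  by apply: eq_rint => x _; rewrite RecM mulNr.
rewrite -!rintZ// -rintD; [|exact: sc..].
by apply: eq_rint => x _; rewrite ImcM.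
Qed.

Lemma cintN a b g : (forall x, contC g x) -> cint a b (fun x => - g x) = - cint a b g.
Proof. by move=> cg; rewrite -mulN1r -cintZ//; apply: eq_cint => x _; rewrite mulN1r. Qed.

Lemma cintB a b g h : (forall x, contC g x) -> (forall x, contC h x) ->
  cint a b (fun x => g x - h x) = cint a b g - cint a b h.
Proof.
move=> cg ch; rewrite -cintN// -cintD// => x; apply: contCN; exact: ch.
Qed.

Lemma cint_cst a b c : a <= b -> cint a b (fun=> c) = c * ((b - a)%:C)%C.
Proof.
move=> ab; apply: complex_ext; [rewrite [RHS]RecM|rewrite [RHS]ImcM]; rewrite /= !rint_cst// ?mulr0 ?subr0 ?add0r//.
Qed.

Lemma cint_id a b : a <= b -> cint a b (fun x => (x%:C)%C) = (((b ^+ 2 - a ^+ 2) / 2)%:C)%C.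
Proof.
by move=> ab; apply: complex_ext => /=; [exact: rint_id|rewrite rint_cst// mul0r].
Qed.

Lemma cint_split a m b g : a <= m -> m <= b -> (forall x, contC g x) ->
  cint a b g = cint a m g + cint m b g.
Proof.
move=> am mb cg; apply: complex_ext; rewrite ?RecD ?ImcD /=; apply: rint_split => //.
  exact: cRe.
exact: cIm.
Qed.

(* The factor 2 comes from bounding real and imaginary parts separately. *)
Lemma nc_cint_le a b M g : a <= b -> (forall x, contC g x) ->
  (forall x, a <= x <= b -> nc (g x) <= M) -> nc (cint a b g) <= 2 * M * (b - a).
Proof.
move=> ab cg h; apply: le_trans (nc_le _) _; rewrite -mulrA mulr_natl mulr2n.
apply: lerD; apply: rint_norm_le => //; try exact: cRe; try exact: cIm.
  by move=> x /h; apply: le_trans; exact: Re_le_nc.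
by move=> x /h; apply: le_trans; exact: Im_le_nc.
Qed.

Lemma contC_real (x : R) : contC (fun y : R => (y%:C)%C : R[i]) x.
Proof.
apply: contCpair; [exact: cvg_id|exact: cvg_cst].
Qed.

End ComplexIntegral.

(** * Goursat's theorem *)

Local Arguments Normc.normc : simpl never.
Local Arguments cint : simpl never.

(** Boundary integral of [p z + q], with [j] for the imaginary unit and [A], [B] for the integrals
    of the abscissa and the ordinate. The horizontal sides leave [p j (c - d) (b - a)], the vertical
    ones its opposite. *)
Lemma affine_cancel (K : comRingType) (p q j A B a b c d : K) :
  p * A + (p * (j * c) + q) * (b - a) - (p * A + (p * (j * d) + q) * (b - a)) +
  j * (p * j * B + (p * b + q) * (d - c) - (p * j * B + (p * a + q) * (d - c))) = 0.
Proof. ring. Qed.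

Section Goursat.
Variable R : realType.
Implicit Types (a b c d m : R) (F G : R[i] -> R[i]) (z w p q : R[i]).

(** Counterclockwise contour integral: [dz] is [dx] on the horizontal sides and [i dy] on the
    vertical ones. *)
Definition bdry a b c d F : R[i] :=
  (cint a b (fun x => F (x +i* c)%C) - cint a b (fun x => F (x +i* d)%C)) +
  'i%C * (cint c d (fun y => F (b +i* y)%C) - cint c d (fun y => F (a +i* y)%C)).

Local Arguments bdry : simpl never.

Definition inrect a b c d z :=
  a <= complex.Re z <= b /\ c <= complex.Im z <= d.

Lemma inrect_dist a b c d z w : inrect a b c d z -> inrect a b c d w ->
  nc (z - w) <= (b - a) + (d - c).
Proof.
move=> [/andP[? ?] /andP[? ?]] [/andP[? ?] /andP[? ?]].
rewrite (le_trans (nc_le _))// RecD ImcD RecN ImcN.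
by apply: lerD; rewrite ler_norml; apply/andP; split; lra.
Qed.

Lemma contC_hor F c : (forall z, contC F z) -> forall x : R, contC (fun x => F (x +i* c)%C) x.
Proof.
move=> cF x; apply: (@contCcomp _ _ _ (fun x : R => (x +i* c)%C) F x); last exact: cF.
by apply/contC_continuous/contCpair; [exact: cvg_id|exact: cvg_cst].
Qed.

Lemma contC_ver F a : (forall z, contC F z) -> forall y : R, contC (fun y => F (a +i* y)%C) y.
Proof.
move=> cF x; apply: (@contCcomp _ _ _ (fun y : R => (a +i* y)%C) F x); last exact: cF.
by apply/contC_continuous/contCpair; [exact: cvg_cst|exact: cvg_id].
Qed.

Lemma bdry_splitx a m b c d F : (forall z, contC F z) -> a <= m -> m <= b ->
  bdry a b c d F = bdry a m c d F + bdry m b c d F.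
Proof.
move=> cF am mb; rewrite /bdry.
by rewrite !(cint_split am mb (contC_hor _ cF)); ring.
Qed.

Lemma bdry_splity a b c m d F : (forall z, contC F z) -> c <= m -> m <= d ->
  bdry a b c d F = bdry a b c m F + bdry a b m d F.
Proof.
move=> cF am mb; rewrite /bdry.
by rewrite !(cint_split am mb (contC_ver _ cF)); ring.
Qed.

Lemma bdryB a b c d F G : (forall z, contC F z) -> (forall z, contC G z) ->
  bdry a b c d (fun z => F z - G z) = bdry a b c d F - bdry a b c d G.
Proof.
move=> cF cG; rewrite /bdry !cintB; try (exact: contC_hor || exact: contC_ver).
ring.
Qed.

Lemma bdry_affine a b c d p q : a <= b -> c <= d -> bdry a b c d (fun z => p * z + q) = 0.
Proof.
move=> ab cd; rewrite /bdry.
have hor e : cint a b (fun x => p * (x +i* e)%C + q) =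
    p * (((b ^+ 2 - a ^+ 2) / 2)%:C)%C + (p * (0 +i* e)%C + q) * ((b - a)%:C)%C.
  rewrite -(cint_id ab) -(cint_cst _ ab) -cintZ; last exact: contC_real.
  rewrite -cintD; last 2 first.
  - by move=> x; apply: contCM; [exact: contCst|exact: contC_real].
  - by move=> x; exact: contCst.
  apply: eq_cint => x _; rewrite addrA -mulrDr; congr (p * _ + q).
  by apply: complex_ext; rewrite /= ?addr0 ?add0r.
have ver e : cint c d (fun y => p * (e +i* y)%C + q) =
    p * 'i%C * (((d ^+ 2 - c ^+ 2) / 2)%:C)%C + (p * (e%:C)%C + q) * ((d - c)%:C)%C.
  rewrite -(cint_id cd) -(cint_cst _ cd) -cintZ; last exact: contC_real.
  rewrite -cintD; last 2 first.
  - by move=> x; apply: contCM; [exact: contCst|exact: contC_real].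
  - by move=> x; exact: contCst.
  apply: eq_cint => x _; rewrite addrA -mulrA -mulrDr; congr (p * _ + q).
  by apply: complex_ext; rewrite /= ?(mul0r, mul1r, mulr0, addr0, add0r, subr0, sub0r, oppr0).
rewrite !hor !ver.
have ie (e : R) : (0 +i* e)%C = 'i%C * (e%:C)%C.
  by apply: complex_ext; rewrite /= ?(mul0r, mul1r, mulr0, addr0, add0r, subr0, sub0r, oppr0).
rewrite (ie c) (ie d).
have -> : ((b - a)%:C = b%:C - a%:C)%C by rewrite rmorphB.
have -> : ((d - c)%:C = d%:C - c%:C)%C by rewrite rmorphB.
exact: affine_cancel.
Qed.

Lemma nc_bdry_le a b c d F (M : R) : (forall z, contC F z) -> a <= b -> c <= d ->
  (forall z, inrect a b c d z -> nc (F z) <= M) ->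
  nc (bdry a b c d F) <= 4 * M * ((b - a) + (d - c)).
Proof.
move=> cF ab cd h.
have h1 : nc (cint a b (fun x => F (x +i* c)%C)) <= 2 * M * (b - a).
  apply: nc_cint_le => // [|x xab]; first exact: contC_hor.
  by apply: h; split=> //=; rewrite lexx.
have h2 : nc (cint a b (fun x => F (x +i* d)%C)) <= 2 * M * (b - a).
  apply: nc_cint_le => // [|x xab]; first exact: contC_hor.
  by apply: h; split=> //=; rewrite lexx andbT.
have h3 : nc (cint c d (fun y => F (b +i* y)%C)) <= 2 * M * (d - c).
  apply: nc_cint_le => // [|x xab]; first exact: contC_ver.
  by apply: h; split=> //=; rewrite lexx andbT.
have h4 : nc (cint c d (fun y => F (a +i* y)%C)) <= 2 * M * (d - c).
  apply: nc_cint_le => // [|x xab]; first exact: contC_ver.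
  by apply: h; split=> //=; rewrite lexx.
rewrite /bdry (le_trans (ncD _ _))// ncM nc_i mul1r.
set x1 := cint a b _ in h1 *; set x2 := cint a b _ in h2 *.
set x3 := cint c d _ in h3 *; set x4 := cint c d _ in h4 *.
have := ncD x1 (- x2); have := ncD x3 (- x4); rewrite !ncN; lra.
Qed.

Lemma nested_intervals (u v : nat -> R) : (forall n, u n <= u n.+1) ->
  (forall n, v n.+1 <= v n) -> (forall n, u n <= v n) ->
  exists p : R, forall n, u n <= p <= v n.
Proof.
move=> uS vS uv.
have um n k : u n <= u (n + k)%N.
  by elim: k => [|k IH]; rewrite ?addn0// addnS (le_trans IH).
have vm n k : v (n + k)%N <= v n.
  by elim: k => [|k IH]; rewrite ?addn0// addnS (le_trans _ IH).
have ub n : ubound (range u) (v n).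
  move=> _ [m _ <-]; apply: le_trans (um m n) _; apply: le_trans (uv _) _.
  by rewrite addnC.
have ne : range u !=set0 by exists (u 0%N), 0%N.
exists (sup (range u)) => n; apply/andP; split.
  by apply: sup_ubound; [exists (v 0%N); exact: ub|exists n].
exact: ge_sup.
Qed.

Lemma half_ge (x y : R[i]) : nc (x + y) <= 2 * nc x \/ nc (x + y) <= 2 * nc y.
Proof.
have := ncD x y; have [h|h] := leP (nc x) (nc y) => hD; [right|left]; lra.
Qed.

Definition rect : Type := ((R * R) * (R * R))%type.
Definition rbdry (r : rect) F := bdry r.1.1 r.1.2 r.2.1 r.2.2 F.
Definition subrect (r s : rect) := [/\ r.1.1 <= s.1.1, s.1.2 <= r.1.2,
  r.2.1 <= s.2.1 & s.2.2 <= r.2.2].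

(** Two bisections, one in each direction; each time one of the halves carries at least half of the
    modulus of the integral. *)
Lemma quarter F (r : rect) : (forall z, contC F z) -> r.1.1 <= r.1.2 -> r.2.1 <= r.2.2 ->
  exists s : rect, [/\ subrect r s, s.1.2 - s.1.1 = (r.1.2 - r.1.1) / 2,
    s.2.2 - s.2.1 = (r.2.2 - r.2.1) / 2 & nc (rbdry r F) <= 4 * nc (rbdry s F)].
Proof.
case: r => [[a b] [c d]] cF /= ab cd.
pose m := (a + b) / 2; pose n := (c + d) / 2.
have [a1 [b1 [aa1 b1b e1 h1]]] : exists a1, exists b1, [/\ a <= a1, b1 <= b, b1 - a1 = (b - a) / 2 &
    nc (bdry a b c d F) <= 2 * nc (bdry a1 b1 c d F)].
  have am : a <= m by rewrite /m; lra.
  have mb : m <= b by rewrite /m; lra.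
  rewrite (bdry_splitx _ _ cF am mb).
  case: (half_ge (bdry a m c d F) (bdry m b c d F)) => h.
    by exists a, m; split => //; rewrite /m; field.
  by exists m, b; split => //; rewrite /m; field.
have [c1 [d1 [cc1 d1d e2 h2]]] : exists c1, exists d1, [/\ c <= c1, d1 <= d, d1 - c1 = (d - c) / 2 &
    nc (bdry a1 b1 c d F) <= 2 * nc (bdry a1 b1 c1 d1 F)].
  have am : c <= n by rewrite /n; lra.
  have mb : n <= d by rewrite /n; lra.
  rewrite (bdry_splity _ _ cF am mb).
  case: (half_ge (bdry a1 b1 c n F) (bdry a1 b1 n d F)) => h.
    by exists c, n; split => //; rewrite /n; field.
  by exists n, d; split => //; rewrite /n; field.
exists ((a1, b1), (c1, d1)); split => //=.
rewrite /rbdry /=; lra.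
Qed.

Lemma diffC_eps F z l : diffC F z l -> forall e : R, 0 < e ->
  exists2 t : R, 0 < t & forall w, nc (w - z) < t ->
    nc (F w - F z - l * (w - z)) <= e * nc (w - z).
Proof.
move=> [q [cq <- eq]] e e0; have /contCP/(_ e e0)/nbhs_ncP[t t0 h] := cq.
by exists t => // w /h/ltW wt; rewrite eq -mulrBl ncM ler_wpM2r// nc_ge0.
Qed.

Lemma goursat a b c d F : (forall z, contC F z) -> a <= b -> c <= d ->
  (forall z, inrect a b c d z -> exists l, diffC F z l) -> bdry a b c d F = 0.
Proof.
move=> cF ab cd dF.
have [f fP] : exists f : rect -> rect, forall r, r.1.1 <= r.1.2 -> r.2.1 <= r.2.2 ->
  [/\ subrect r (f r), (f r).1.2 - (f r).1.1 = (r.1.2 - r.1.1) / 2,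
    (f r).2.2 - (f r).2.1 = (r.2.2 - r.2.1) / 2 & nc (rbdry r F) <= 4 * nc (rbdry (f r) F)].
  have /choice[f fP] : forall r : rect, exists s : rect, r.1.1 <= r.1.2 -> r.2.1 <= r.2.2 ->
      [/\ subrect r s, s.1.2 - s.1.1 = (r.1.2 - r.1.1) / 2,
      s.2.2 - s.2.1 = (r.2.2 - r.2.1) / 2 & nc (rbdry r F) <= 4 * nc (rbdry s F)].
    move=> r; have [h1|h1] := leP r.1.1 r.1.2; last by exists r.
    have [h2|h2] := leP r.2.1 r.2.2; last by exists r.
    by have [s sP] := quarter cF h1 h2; exists s.
  by exists f.
pose r n := iter n f ((a, b), (c, d)).
have rP n : [/\ (r n).1.2 - (r n).1.1 = (b - a) / 2 ^+ n,
    (r n).2.2 - (r n).2.1 = (d - c) / 2 ^+ n &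
    nc (bdry a b c d F) <= 4 ^+ n * nc (rbdry (r n) F)].
  elim: n => [|n [e1 e2 h]]; first by rewrite !expr0 !divr1 mul1r.
  have /fP : (r n).1.1 <= (r n).1.2 by rewrite -subr_ge0 e1 divr_ge0 ?subr_ge0// exprn_ge0.
  have h2 : (r n).2.1 <= (r n).2.2 by rewrite -subr_ge0 e2 divr_ge0 ?subr_ge0// exprn_ge0.
  move=> /(_ h2)[_ e3 e4 h4]; rewrite -/(r n.+1) in e3 e4 h4.
  have V k (x : R) : x / 2 ^+ k / 2 = x / 2 ^+ k.+1 by rewrite exprSr invfM mulrA.
  split; [by rewrite e3 e1 V|by rewrite e4 e2 V|].
  by rewrite (le_trans h)// exprSr -mulrA ler_wpM2l// exprn_ge0.
have ord n : (r n).1.1 <= (r n).1.2 /\ (r n).2.1 <= (r n).2.2.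
  have [e1 e2 _] := rP n.
  by split; rewrite -subr_ge0 ?e1 ?e2 divr_ge0 ?subr_ge0// exprn_ge0.
have sub n : subrect (r n) (r n.+1).
  by have [u1 u2] := ord n; have [] := fP _ u1 u2.
have [x xP] : exists x : R, forall n, (r n).1.1 <= x <= (r n).1.2.
  by apply: nested_intervals => n; [case: (sub n)|case: (sub n)|case: (ord n)].
have [y yP] : exists y : R, forall n, (r n).2.1 <= y <= (r n).2.2.
  by apply: nested_intervals => n; [case: (sub n)|case: (sub n)|case: (ord n)].
pose p := (x +i* y)%C; pose s := (b - a) + (d - c).
have s0 : 0 <= s by rewrite addr_ge0// subr_ge0.
have [l dl] : exists l, diffC F p l by apply: dF; split; [exact: (xP 0%N)|exact: (yP 0%N)].
(* The affine part of [F] at [p] integrates to 0. The remainder is at most [e (s / 2^n)] on a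
   rectangle whose side lengths add up to [s / 2^n], so its integral is of order [4^-n], which
   compensates the factor [4^n] lost by the subdivisions. *)
have small (e : R) : 0 < e -> nc (bdry a b c d F) <= 4 * e * s ^+ 2.
  move=> e0; have [t t0 tP] := diffC_eps dl e0.
  have [n sn] : exists n : nat, s / 2 ^+ n < t.
    have := archi_boundP (divr_ge0 s0 (ltW t0)); set n := Num.bound _ => hn.
    exists n; rewrite ltr_pdivrMr ?exprn_gt0// mulrC -ltr_pdivrMr//.
    by rewrite (lt_le_trans hn)// -natrX ler_nat ltnW// ltn_expl.
  have [e1 e2 h] := rP n; have [u1 u2] := ord n.
  have cA z : contC (fun z => l * z + (F p - l * p)) z.
    by apply: contCD; [apply: contCM; [exact: contCst|exact: contCid]|exact: contCst].
  have := bdryB (r n).1.1 (r n).1.2 (r n).2.1 (r n).2.2 cF cA.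
  rewrite bdry_affine// subr0 => eb.
  apply: (le_trans h); rewrite /rbdry -eb.
  have -> : 4 * e * s ^+ 2 = 4 ^+ n * (4 * (e * (s / 2 ^+ n)) * (s / 2 ^+ n)).
    have -> : 4 ^+ n = 2 ^+ n * 2 ^+ n :> R by rewrite -exprMn; congr (_ ^+ _); ring.
    by field; rewrite expf_neq0.
  rewrite ler_wpM2l ?exprn_ge0//.
  have -> : s / 2 ^+ n = ((r n).1.2 - (r n).1.1) + ((r n).2.2 - (r n).2.1).
    by rewrite e1 e2 -mulrDl.
  apply: nc_bdry_le => //.
    by move=> z; apply: contCB; [exact: cF|exact: cA].
  move=> z [z1 z2].
  have dz : nc (z - p) <= ((r n).1.2 - (r n).1.1) + ((r n).2.2 - (r n).2.1).
    by apply: inrect_dist => //; split.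
  have -> : F z - (l * z + (F p - l * p)) = F z - F p - l * (z - p) by ring.
  apply: le_trans (tP z _) _; last by rewrite ler_wpM2l// ltW.
  by rewrite (le_lt_trans dz)// e1 e2 -mulrDl.
apply/eqP; rewrite -nc_eq0 eq_le nc_ge0 andbT leNgt; apply/negP => J0.
(* The [+ 1] keeps the denominator positive for a rectangle reduced to a point, and makes the
   resulting inequality strictly contradictory. *)
have k0 : 0 < 4 * s ^+ 2 + 1 by rewrite ltr_wpDl// mulr_ge0// sqr_ge0.
have := small (nc (bdry a b c d F) / (4 * s ^+ 2 + 1)).
rewrite divr_gt0// => /(_ isT); set J := nc _ in J0 *.
have -> : 4 * (J / (4 * s ^+ 2 + 1)) * s ^+ 2 = J * (4 * s ^+ 2) / (4 * s ^+ 2 + 1).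
  by field; rewrite gt_eqF.
by rewrite ler_pdivlMr// ler_pM2l// gerDl ler10.
Qed.

(** The rectangle minus a small square around [z0] splits into four rectangles to which [goursat]
    applies. Continuity bounds [F] on the square, so the integral over its boundary tends to 0 with
    its side. *)
Lemma goursat_puncture a b c d F z0 : (forall z, contC F z) ->
  a < complex.Re z0 < b -> c < complex.Im z0 < d ->
  (forall z, inrect a b c d z -> z != z0 -> exists l, diffC F z l) -> bdry a b c d F = 0.
Proof.
case: z0 => x0 y0 /= cF /andP[ax xb] /andP[cy yd] dF.
have small (t : R) : 0 < t -> a < x0 - t -> x0 + t < b -> c < y0 - t -> y0 + t < d ->
    bdry a b c d F = bdry (x0 - t) (x0 + t) (y0 - t) (y0 + t) F.
  move=> t0 h1 h2 h3 h4.
  rewrite (@bdry_splitx a (x0 - t) b)//; [|lra|lra].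
  rewrite (@bdry_splitx (x0 - t) (x0 + t) b)//; [|lra|lra].
  rewrite (@bdry_splity (x0 - t) (x0 + t) c (y0 - t) d)//; [|lra|lra].
  rewrite (@bdry_splity (x0 - t) (x0 + t) (y0 - t) (y0 + t) d)//; [|lra|lra].
  rewrite (@goursat a (x0 - t) c d)//; [|lra|lra|]; last first.
    move=> [x y] [/= /andP[? ?] /andP[? ?]]; apply: dF; first by split=> /=; apply/andP; split; lra.
    by rewrite eq_complex /= negb_and; apply/orP; left; apply/eqP; lra.
  rewrite (@goursat (x0 + t) b c d)//; [|lra|lra|]; last first.
    move=> [x y] [/= /andP[? ?] /andP[? ?]]; apply: dF; first by split=> /=; apply/andP; split; lra.
    by rewrite eq_complex /= negb_and; apply/orP; left; apply/eqP; lra.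
  rewrite (@goursat (x0 - t) (x0 + t) c (y0 - t))//; [|lra|lra|]; last first.
    move=> [x y] [/= /andP[? ?] /andP[? ?]]; apply: dF; first by split=> /=; apply/andP; split; lra.
    by rewrite eq_complex /= negb_and; apply/orP; right; apply/eqP; lra.
  rewrite (@goursat (x0 - t) (x0 + t) (y0 + t) d)//; [|lra|lra|]; last first.
    move=> [x y] [/= /andP[? ?] /andP[? ?]]; apply: dF; first by split=> /=; apply/andP; split; lra.
    by rewrite eq_complex /= negb_and; apply/orP; right; apply/eqP; lra.
  by rewrite !(add0r, addr0).
have /contCP/(_ 1 ltr01)/nbhs_ncP[e e0 eP] := cF (x0 +i* y0)%C.
pose M := nc (F (x0 +i* y0)%C) + 1.
have M0 : 0 < M by rewrite ltr_wpDl// nc_ge0.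
apply/eqP; rewrite -nc_eq0 eq_le nc_ge0 andbT leNgt; apply/negP => J0.
set J := nc _ in J0.
(* [e / 4] keeps the square in the disc where [nc F <= M], the half-gaps keep it inside the
   rectangle, and [J / (32 * M)] turns the bound [16 M t] into [J / 2]. *)
pose t := Num.min (e / 4) (Num.min (Num.min ((x0 - a) / 2) ((b - x0) / 2))
  (Num.min (Num.min ((y0 - c) / 2) ((d - y0) / 2)) (J / (32 * M)))).
have t0 : 0 < t by rewrite /t !lt_min !divr_gt0 ?subr_gt0 ?mulr_gt0.
have : t <= t by [].
rewrite {2}/t !le_min => /and3P[te /andP[t1 t2] /andP[/andP[t3 t4] t5]].
have : J <= 4 * M * ((x0 + t - (x0 - t)) + (y0 + t - (y0 - t))).
  rewrite /J (small t)//; [|lra..].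
  apply: nc_bdry_le => //; [lra|lra|].
  move=> [x y] [/= /andP[? ?] /andP[? ?]].
  apply: le_trans (ncDB _ (F (x0 +i* y0)%C)) _; rewrite lerD2l ltW// eP//.
  apply: le_lt_trans (nc_le _) _; rewrite /=.
  have : `|x - x0| <= t by rewrite ler_norml; apply/andP; split; lra.
  have : `|y - y0| <= t by rewrite ler_norml; apply/andP; split; lra.
  lra.
have : 32 * M * t <= J by rewrite mulrC -ler_pdivlMr// mulr_gt0.
nra.
Qed.

End Goursat.

(** * Laurent coefficients *)

Local Arguments bdry : simpl never.
Local Arguments cexp : simpl never.

(** * Local differentiability and difference quotients *)

Section LocalDiff.
Variable R : realType.
Implicit Types (F G q : R[i] -> R[i]) (z w l : R[i]).

(** [diffC] asks for a factorisation over the whole plane; away from [z] the plain difference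
    quotient completes a local one without affecting continuity at [z]. *)
Lemma diffC_local F q z : contC q z ->
  (\forall w \near z, F w - F z = q w * (w - z)) -> diffC F z (q z).
Proof.
move=> cq /nbhs_ncP[d d0 hd].
exists (fun w => if nc (w - z) < d then q w else (F w - F z) / (w - z)); split.
- apply/contCP => e e0; move/contCP: cq => /(_ e e0)/nbhs_ncP[t t0 ht].
  apply/nbhs_ncP; exists (Num.min d t); first by rewrite lt_min d0.
  by move=> w; rewrite lt_min subrr nc0 d0 => /andP[-> /ht].
- by rewrite subrr nc0 d0.
- move=> w; case: ifPn => [/hd//|].
  have [->|wz] := eqVneq w z; first by rewrite subrr nc0 d0.
  by rewrite divfK// subr_eq0.
Qed.

Lemma diffC_near F G z l : (\forall w \near z, F w = G w) -> diffC F z l -> diffC G z l.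
Proof.
move=> h [q [cq <- e]]; apply: diffC_local => //.
by have hz := nbhs_singleton h; near=> w; rewrite -hz -(near h w)// e.
Unshelve. all: by end_near. Qed.

Lemma diffC_subV z w : w != z -> diffC (fun v => (v - z)^-1) w (- ((w - z)^-1 / (w - z))).
Proof.
move=> wz; have wz0 : w - z != 0 by rewrite subr_eq0.
apply: (@diffC_local _ (fun v => - ((v - z)^-1 / (w - z)))).
  apply: contCN; apply: contCM; last exact: contCst.
  by apply: contCV => //; apply: contCB; [exact: contCid|exact: contCst].
apply/nbhs_ncP; exists (nc (w - z)); first by rewrite nc_gt0.
move=> v; have [->|vz _] := eqVneq v z; first by rewrite ncB ltxx.
have vz0 : v - z != 0 by rewrite subr_eq0.
by field; rewrite wz0.
Qed.

(** The slope function extends continuously over [z], but its differentiability there is not yet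
    available; this is why Goursat's theorem is needed with a puncture. *)
Lemma diffC_quotient F z : (forall w, exists l, diffC F w l) ->
  exists q : R[i] -> R[i], [/\ forall w, contC q w,
    forall w, w != z -> exists l, diffC q w l
    & forall w, F w - F z = q w * (w - z)].
Proof.
move=> dF; have [l [q [cq _ eq]]] := dF z.
have dq w : w != z -> exists l, diffC q w l.
  move=> wz; have [m dm] := dF w.
  have := diffC_mul (diffC_sub dm (diffC_cst (F z) w)) (diffC_subV wz).
  set k := (X in diffC _ _ X) => hk; exists k; apply: diffC_near hk.
  apply/nbhs_ncP; exists (nc (w - z)); first by rewrite nc_gt0 subr_eq0.
  move=> v; have [->|vz _] := eqVneq v z; first by rewrite ncB ltxx.
  by rewrite eq mulfK// subr_eq0.
exists q; split => // w; have [->//|/dq[k]] := eqVneq w z.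
exact: diffC_cont.
Qed.

End LocalDiff.

Section Circles.
Variable R : realType.
Implicit Types (f G : R[i] -> R[i]) (z w : R[i]) (s : R) (n N : nat).
Local Notation pi := (@pi R).

(** With [w = e^(s + i t)] one has [dw = i w dt]: this is the integral of [dw / (i w)] against [G],
    over the circle of radius [e^s]. *)
Definition circ s G : R[i] := cint (- pi) pi (fun t => G (s +i* t)%C).

Lemma Npi_le_pi : - pi <= pi. Proof. by rewrite ge0_cp ?pi_ge0. Qed.

(** Periodicity cancels the two horizontal sides of the contour, leaving [i] times the difference of
    the vertical integrals. *)
Lemma circ_const s1 s2 G : (forall z, contC G z) ->
  (forall s, G (s +i* pi)%C = G (s +i* (- pi))%C) ->
  bdry s1 s2 (- pi) pi G = 0 -> circ s1 G = circ s2 G.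
Proof.
move=> cG per; rewrite /bdry (eq_cint (h := fun x => G (x +i* pi)%C)).
  rewrite subrr add0r => /eqP; rewrite mulf_eq0 -nc_eq0 nc_i oner_eq0 /= subr_eq0.
  by move=> /eqP.
by move=> x _; rewrite per.
Qed.

Lemma cexp_per s : cexp (s +i* pi)%C = cexp (s +i* (- pi))%C :> R[i].
Proof. by rewrite /cexp /= cosN sinN sinpi oppr0. Qed.

Lemma nc_contC (X : topologicalType) (g : X -> R[i]) x : contC g x ->
  {for x, continuous (fun y => nc (g y))}.
Proof.
move=> /contCP h; apply/cvgrPdist_lt => e /h; apply: filterS => y; apply: le_lt_trans.
rewrite ler_norml; have := ncDB (g x) (g y); have := ncDB (g y) (g x).
by rewrite (ncB (g x)) => h1 h2; apply/andP; split; lra.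
Qed.

Lemma circ_bounded s G : (forall z, contC G z) ->
  exists2 M, 0 <= M & forall t, - pi <= t <= pi -> nc (G (s +i* t)%C) <= M.
Proof.
move=> cG.
have [|c _ cP] := @EVT_max R (fun t => nc (G (s +i* t)%C)) _ _ Npi_le_pi.
  by apply: continuous_subspaceT => t; apply: nc_contC; exact: contC_ver.
exists (nc (G (s +i* c)%C)); first exact: nc_ge0.
by move=> t tpi; apply: cP; rewrite in_itv.
Qed.

Lemma nc_circ_le s G M : (forall z, contC G z) ->
  (forall t, - pi <= t <= pi -> nc (G (s +i* t)%C) <= M) ->
  nc (circ s G) <= 4 * M * pi.
Proof.
move=> cG h; have := nc_cint_le Npi_le_pi (contC_ver s cG) h; rewrite -/(circ s G).
by move=> /le_trans; apply; have := @pi_gt0 R; nra.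
Qed.

Lemma circD s G H : (forall z, contC G z) -> (forall z, contC H z) ->
  circ s (fun z => G z + H z) = circ s G + circ s H.
Proof. by move=> cG cH; apply: cintD; exact: contC_ver. Qed.

Lemma circB s G H : (forall z, contC G z) -> (forall z, contC H z) ->
  circ s (fun z => G z - H z) = circ s G - circ s H.
Proof. by move=> cG cH; apply: cintB; exact: contC_ver. Qed.

Lemma circZ s c G : (forall z, contC G z) -> circ s (fun z => c * G z) = c * circ s G.
Proof. by move=> cG; apply: cintZ; exact: contC_ver. Qed.

(* In the coordinate [w = exp z], the integrand of the n-th Laurent
   coefficient [f(w) w^-n]. *)
Definition laur f n z := f (cexp z) * cexp (- (n%:R * z)).

Lemma laur_diff f n : (forall w, exists l, diffC f w l) ->
  forall z, exists l, diffC (laur f n) z l.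
Proof.
move=> df z; have [l dl] := df (cexp z).
have d1 := diffC_comp (diffC_cexp z) dl.
have d2 := diffC_opp (diffC_mul (diffC_cst n%:R z) (diffC_id z)).
have d3 := diffC_comp d2 (diffC_cexp _).
by have := diffC_mul d1 d3; set k := (X in diffC _ _ X) => h; exists k.
Qed.

Lemma laur_contC f n : (forall w, exists l, diffC f w l) -> forall z, contC (laur f n) z.
Proof. by move=> df z; have [l] := laur_diff n df z; exact: diffC_cont. Qed.

Lemma cexpNn n z : cexp (- (n%:R * z)) = (cexp z) ^- n.
Proof. by rewrite cexpN cexpMn. Qed.

Lemma laur_const f n s1 s2 : (forall w, exists l, diffC f w l) ->
  circ s1 (laur f n) = circ s2 (laur f n).
Proof.
move=> df; wlog s12 : s1 s2 / s1 <= s2 => [h|].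
  by have [/h//|/ltW/h//] := leP s1 s2.
apply: circ_const; first exact: laur_contC.
  by move=> s; rewrite /laur !cexpNn cexp_per.
by apply: goursat => //; [exact: laur_contC|exact: Npi_le_pi|move=> z _; exact: laur_diff].
Qed.

(** The n-th Fourier coefficient of [f] on the unit circle. It is the Taylor coefficient, but that
    identification has to wait until power series are differentiated. *)
Definition coef f n : R[i] := (2 * pi)^-1%:C%C * circ 0 (laur f n).

Lemma circ_laur f n s : (forall w, exists l, diffC f w l) ->
  circ s (laur f n) = (2 * pi)%:C%C * coef f n.
Proof.
move=> df; rewrite (laur_const n s 0 df) /coef mulrA -rmorphM /= mulfV ?mul1r//.
by rewrite mulf_neq0// ?gt_eqF// pi_gt0.
Qed.

Lemma circ_laur1 n s : circ s (laur (fun=> 1) n) = if n == 0%N then (2 * pi)%:C%C else 0.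
Proof.
have d1 w : exists l, diffC (fun=> 1 : R[i]) w l by exists 0; exact: diffC_cst.
case: eqP => [->|/eqP n0].
  rewrite /circ (eq_cint (h := fun=> 1)).
    by rewrite cint_cst ?Npi_le_pi// mul1r; congr (_%:C)%C; ring.
  by move=> t _; rewrite /laur mul0r oppr0 cexp0 mulr1.
(* The integrals at abscissas 0 and 1 are equal, and their ratio is [e^-n]. *)
have e : circ 1 (laur (fun=> 1) n) = cexp (- n%:R) * circ 0 (laur (fun=> 1) n).
  rewrite -circZ; last exact: laur_contC.
  apply: eq_cint => t _; rewrite /laur !mul1r -cexpD; congr cexp.
  rewrite -opprD; congr (- _); rewrite -{2}[n%:R]mulr1 -mulrDr; congr (_ * _).
  by apply: complex_ext; rewrite /= ?addr0 ?add0r.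
rewrite (laur_const n s 0 d1); move: e; rewrite (laur_const n 1 0 d1) => /eqP.
rewrite -[X in X == _]mul1r -subr_eq0 -mulrBl mulf_eq0 => /orP[|/eqP//].
rewrite subr_eq0 => /eqP e; have : nc (cexp (- n%:R : R[i])) = 1 by rewrite -e nc1.
rewrite nc_cexp RecN -(rmorph_nat (real_complex R)) /= => /eqP.
by rewrite lt_eqF// expR_lt1 oppr_lt0 ltr0n lt0n.
Qed.

End Circles.

(** * Taylor expansion *)

Section Taylor.
Variable R : realType.
Implicit Types (f G : R[i] -> R[i]) (z w : R[i]) (s : R) (n N : nat).
Local Notation pi := (@pi R).

Lemma exists_half_exp (x e : R) : 0 < e -> exists n : nat, x / 2 ^+ n < e.
Proof.
move=> e0; have [x0|x0] := ltP x 0.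
  by exists 0%N; rewrite expr0 divr1 (lt_trans x0).
have := archi_boundP (divr_ge0 x0 (ltW e0)); set n := Num.bound _ => hn.
exists n; rewrite ltr_pdivrMr ?exprn_gt0// mulrC -ltr_pdivrMr//.
by rewrite (lt_le_trans hn)// -natrX ler_nat ltnW// ltn_expl.
Qed.

Lemma le_half_exp (x y c : R) : (forall n, x <= y + c / 2 ^+ n) -> x <= y.
Proof.
move=> h; rewrite leNgt; apply/negP; rewrite -subr_gt0 => /(exists_half_exp c)[n hn].
have := h n; lra.
Qed.

Definition psum (a : nat -> R[i]) N z : R[i] := \sum_(n < N) a n * z ^+ n.

Lemma psumS a N z : psum a N.+1 z = psum a N z + a N * z ^+ N.
Proof. by rewrite /psum big_ord_recr. Qed.

Lemma psum_contC a N z : contC (psum a N) z.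
Proof.
elim: N => [|N IH].
  by rewrite (_ : psum a 0 = fun=> 0); [exact: contCst|apply/funext => w; rewrite /psum big_ord0].
rewrite (_ : psum a N.+1 = fun w => psum a N w + a N * w ^+ N).
  apply: contCD => //; apply: contCM; first exact: contCst.
  by apply: contCX; exact: contCid.
by apply/funext => w; rewrite psumS.
Qed.

Section Pointwise.
Variables (f : R[i] -> R[i]).
Hypothesis df : forall w, exists l, diffC f w l.

(** Since [w q(w) dt] is [q(w) dw] up to the factor [i], this is Cauchy's formula when [q] is the
    slope of [f] at [cexp zeta]. The bound on the imaginary part of [zeta] puts the puncture off the
    horizontal sides. *)
Lemma circ_quotient0 (q : R[i] -> R[i]) (zeta : R[i]) s :
  `|complex.Im zeta| < pi -> complex.Re zeta < s ->
  (forall w, contC q w) -> (forall w, w != cexp zeta -> exists l, diffC q w l) ->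
  circ s (fun z => cexp z * q (cexp z)) = 0.
Proof.
rewrite ltr_norml => imz res cq dq; set G := fun z => _.
have cG z : contC G z.
  apply: contCM; first exact: diffC_cont (diffC_cexp z).
  apply: contCcomp; last exact: cq.
  by apply/contC_continuous; exact: diffC_cont (diffC_cexp z).
(* The integral does not depend on [s], even across the puncture [zeta], and
   is [O(e^s)] as [s] tends to [-oo]. *)
have small s0 : s0 < complex.Re zeta -> circ s G = circ s0 G.
  move=> s0z; apply/esym/circ_const => //.
    by move=> t; rewrite /G cexp_per.
  apply: (@goursat_puncture _ _ _ _ _ _ zeta) => //; first by rewrite s0z.
  move=> z [zr /andP[zi1 zi2]] zz; have [|l dl] := dq (cexp z).
    apply: contra_neq zz; apply: cexp_inj.
    by move: imz => /andP[? ?]; rewrite ltr_norml; apply/andP; split; lra.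
  have h := diffC_mul (diffC_cexp z) (diffC_comp (diffC_cexp z) dl).
  by move: h; set k := (X in diffC _ _ X) => h; exists k.
have /contCP/(_ 1 ltr01)/nbhs_ncP[d d0 hd] := cq 0.
pose M := nc (q 0) + 1.
have M0 : 0 < M by rewrite ltr_wpDl// nc_ge0.
have pi0 := @pi_gt0 R.
apply/eqP; rewrite -nc_eq0 eq_le nc_ge0 andbT leNgt; apply/negP => J0.
set J := nc _ in J0.
(* [e] is the radius of the small circle: below [d] it gives [nc q <= M], below [expR (Re zeta)] it
   keeps the circle inside the puncture, and below [J / (4 M pi)] it contradicts the bound on the
   integral. Halving makes all three strict. *)
pose e := Num.min d (Num.min (expR (complex.Re zeta)) (J / (4 * M * pi))) / 2.
have e0 : 0 < e by rewrite /e divr_gt0// !lt_min d0 expR_gt0 divr_gt0// !mulr_gt0.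
have [s0 es0] := expR_total e0.
have : e < Num.min d (Num.min (expR (complex.Re zeta)) (J / (4 * M * pi))).
  by rewrite -/(e * 2) in e0 *; rewrite {1}/e ltr_pdivrMr// ltr_pMr ?ltr1n// !lt_min d0 expR_gt0 divr_gt0// !mulr_gt0.
rewrite !lt_min => /and3P[ed ez eJ].
have : J <= 4 * (e * M) * pi.
  rewrite /J (small s0); last by rewrite -ltr_expR es0.
  apply: nc_circ_le => // t _; rewrite /G ncM nc_cexp /= es0 ler_wpM2l ?(ltW e0)//.
  apply: le_trans (ncDB _ (q 0)) _; rewrite lerD2l ltW//; apply: hd.
  by rewrite subr0 nc_cexp /= es0.
by move: eJ; rewrite ltr_pdivlMr ?mulr_gt0//; nra.
Qed.

(** A pointwise statement: [C] depends on [zeta] through the bound of the slope function on a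
    circle. Uniformity is recovered later from the growth of the coefficients. *)
Lemma taylor_log (zeta : R[i]) : `|complex.Im zeta| < pi ->
  exists C, forall N, nc (f (cexp zeta) - psum (coef f) N.+1 (cexp zeta)) <= C / 2 ^+ N.
Proof.
move=> imz; set z0 := cexp zeta.
have [q [cq dq eq]] := diffC_quotient z0 df.
have n0 : 0 < nc z0 by rewrite nc_cexp expR_gt0.
(* A circle of twice the modulus of [z0], so that each iteration gains a factor 1/2. *)
have [s es] : exists s, expR s = 2 * nc z0 by apply: expR_total; rewrite mulr_gt0.
have zs : complex.Re zeta < s by rewrite -ltr_expR -nc_cexp es; lra.
pose g z := cexp z * q (cexp z).
have cexpc z : contC (@cexp R) z by exact: diffC_cont (diffC_cexp z).
have cg z : contC g z.
  apply: contCM; first exact: cexpc.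
  by apply: contCcomp; [exact/contC_continuous|exact: cq].
have clN n z : contC (fun z => cexp (- (n%:R * z))) z.
  apply: (@contCcomp _ _ _ (fun z : R[i] => - (n%:R * z)) (@cexp R)); last exact: cexpc.
  by apply/contC_continuous/contCN/contCM; [exact: contCst|exact: contCid].
pose h n z := cexp (- (n%:R * z)) * g z.
have ch n z : contC (h n) z by exact: contCM.
have d1 w : exists l, diffC (fun=> 1 : R[i]) w l by exists 0; exact: diffC_cst.
have h0 : circ s (h 0%N) = 0.
  rewrite -[RHS](circ_quotient0 imz zs cq dq); apply: eq_cint => t _.
  by rewrite /h mul0r oppr0 cexp0 mul1r.
have pi0 := @pi_gt0 R.
have p0 : (2 * pi)%:C%C != 0 :> R[i] by rewrite -nc_eq0 nc_real normr_eq0 mulf_neq0// gt_eqF.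
(* For [w = e^z], [w q(w) = (f(w) - f(z0)) + (z0 / w) (w q(w))]: iterating this
   identity produces the coefficients one by one. *)
have hS n : circ s (h n) =
    (2 * pi)%:C%C * (coef f n - (if n == 0%N then f z0 else 0)) + z0 * circ s (h n.+1).
  have -> : (2 * pi)%:C%C * (coef f n - (if n == 0%N then f z0 else 0)) =
      circ s (laur f n) - f z0 * circ s (laur (fun=> 1) n).
    rewrite circ_laur// circ_laur1 mulrBr; congr (_ - _).
    by case: eqP; rewrite ?mulr0// mulrC.
  rewrite -!circZ; [|by []|by move=> z; exact: laur_contC].
  rewrite -circB; last 2 first.
  - by move=> z; exact: laur_contC.
  - by move=> z; apply: contCM; [exact: contCst|exact: laur_contC].
  rewrite -circD; last 2 first.
  - move=> z; apply: contCB; first exact: laur_contC.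
    by apply: contCM; [exact: contCst|exact: laur_contC].
  - by move=> z; apply: contCM; [exact: contCst|exact: ch].
  apply: eq_cint => t _; set z := (s +i* t)%C.
  have e1 : cexp (- (n.+1%:R * z)) = cexp (- (n%:R * z)) / cexp z.
    by rewrite -cexpN -cexpD; congr cexp; rewrite -natr1; ring.
  have := eq (cexp z); rewrite /laur /h /g e1 mul1r.
  have := cexp_neq0 z; move: (cexp z) (cexp _) => u w w0 ew.
  have -> : f w = q w * (w - z0) + f z0 by rewrite -ew subrK.
  by field.
(* Cauchy's formula, [h0], starts the induction; the left side is then the remainder of the Taylor
   expansion at [z0]. *)
have hN n : z0 ^+ n.+1 * circ s (h n.+1) = (2 * pi)%:C%C * (f z0 - psum (coef f) n.+1 z0).
  elim: n => [|n IH].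
    have := hS 0%N; rewrite h0 eqxx psumS /psum big_ord0 add0r expr0 mulr1 expr1.
    by move=> /esym; rewrite addrC => /eqP; rewrite addr_eq0 => /eqP ->; rewrite mulrBr opprB -mulrBr.
  rewrite psumS opprD addrA mulrDr -IH (hS n.+1) /=.
  by rewrite [z0 ^+ n.+2]exprSr; ring.
have [M M0 hM] := circ_bounded s cg.
exists (2 * M) => N.
have : nc ((2 * pi)%:C%C * (f z0 - psum (coef f) N.+1 z0)) <= (2 * pi) * (2 * M / 2 ^+ N.+1).
  rewrite -hN ncM ncX.
  have : nc (circ s (h N.+1)) <= 4 * ((2 * nc z0) ^- N.+1 * M) * pi.
    apply: nc_circ_le => // t tpi; rewrite /h ncM ler_pM ?nc_ge0 ?hM//.
    by rewrite cexpNn ncV ncX nc_cexp /= es.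
  move=> /(ler_wpM2l (exprn_ge0 N.+1 (nc_ge0 z0))) /le_trans; apply.
  rewrite exprMn invfM le_eqVlt; apply/orP; left; apply/eqP.
  by field; rewrite !expf_neq0// gt_eqF.
rewrite ncM nc_real ger0_norm ?mulr_ge0 ?(ltW pi0)// ler_pM2l ?mulr_gt0// => /le_trans; apply.
rewrite ler_wpM2l ?mulr_ge0// lef_pV2 ?posrE ?exprn_gt0//.
by rewrite exprS ler_peMl ?exprn_ge0// ler1n.
Qed.

Definition growth (a : nat -> R[i]) :=
  forall r : R, 0 < r -> exists2 C, 0 <= C & forall n, nc (a n) * r ^+ n <= C.

(** Cauchy's estimates, on the circle of radius [r]. *)
Lemma coef_growth : growth (coef f).
Proof.
move=> r r0; have [s es] := expR_total r0.
have cf z : contC (fun z => f (cexp z)) z.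
  apply: contCcomp; first by apply/contC_continuous; exact: diffC_cont (diffC_cexp z).
  by have [l] := df (cexp z); exact: diffC_cont.
have [M M0 hM] := circ_bounded s cf.
have pi0 := @pi_gt0 R.
exists (2 * M) => [|n]; first by rewrite mulr_ge0.
have : nc (circ s (laur f n)) <= 4 * (M * r ^- n) * pi.
  apply: nc_circ_le => [z|t tpi]; first exact: laur_contC.
  rewrite /laur ncM ler_pM ?nc_ge0 ?hM//.
  by rewrite cexpNn ncV ncX nc_cexp /= es.
rewrite circ_laur// ncM nc_real ger0_norm ?mulr_ge0 ?(ltW pi0)//.
have -> : 4 * (M * r ^- n) * pi = 2 * pi * (2 * M / r ^+ n) by ring.
by rewrite ler_pM2l ?mulr_gt0// ler_pdivlMr ?exprn_gt0.
Qed.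

End Pointwise.

Lemma sum_tail (b : nat -> R[i]) (D : R) N k : (forall n, nc (b n) <= D / 2 ^+ n) ->
  nc (\sum_(n < N + k) b n - \sum_(n < N) b n) <= 2 * D / 2 ^+ N.
Proof.
move=> bD; have D0 : 0 <= D.
  by have := bD 0%N; rewrite expr0 divr1; apply: le_trans; exact: nc_ge0.
suff : nc (\sum_(n < N + k) b n - \sum_(n < N) b n) <= 2 * D / 2 ^+ N - 2 * D / 2 ^+ (N + k).
  by move=> /le_trans; apply; rewrite gerBl divr_ge0 ?mulr_ge0// exprn_ge0.
elim: k => [|k IH]; first by rewrite addn0 !subrr nc0.
rewrite addnS big_ord_recr /= addrAC (le_trans (ncD _ _))// (le_trans (lerD IH (bD _)))//.
rewrite [2 ^+ (N + k).+1]exprSr.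
have -> : 2 * D / (2 ^+ (N + k) * 2) = D / 2 ^+ (N + k) by field; rewrite expf_neq0.
lra.
Qed.

Lemma psum_tail a (r C : R) z N k : nc z <= r ->
  (forall n, nc (a n) * (2 * r) ^+ n <= C) ->
  nc (psum a (N + k) z - psum a N z) <= 2 * C / 2 ^+ N.
Proof.
move=> zr aC; apply: (@sum_tail (fun n => a n * z ^+ n)) => n.
rewrite ler_pdivlMr ?exprn_gt0// ncM ncX; apply: le_trans (aC n).
have r0 := le_trans (nc_ge0 z) zr.
rewrite exprMn -mulrA ler_wpM2l ?nc_ge0// mulrC ler_wpM2l ?exprn_ge0//.
by rewrite lerXn2r ?nnegrE ?nc_ge0.
Qed.

(** [growth] says that the radius of convergence is infinite, so any geometric rate would do on a
    disc; fixing [2 ^- N] keeps the later limits explicit. *)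
Definition expands (a : nat -> R[i]) f :=
  growth a /\ forall r : R, 0 < r -> exists2 B : R, 0 <= B &
    forall N z, nc z <= r -> nc (f z - psum a N z) <= B / 2 ^+ N.

Theorem expands_coef f : (forall w, exists l, diffC f w l) -> expands (coef f) f.
Proof.
move=> df; have gf := coef_growth df; split => // r r0.
(* The radius is [r + 1] because points of the negative half-line will be approached by [z + i t]
   with [t <= 1], which may leave the disc of radius [r]. *)
have [|C C0 hC] := gf (2 * (r + 1)); first by rewrite mulr_gt0// addr_gt0.
have r1 : 0 < r + 1 by rewrite addr_gt0.
exists (2 * C) => [|N]; first by rewrite mulr_ge0.
have good z : nc z <= r + 1 -> 0 < complex.Re z \/ complex.Im z != 0 ->
    nc (f z - psum (coef f) N z) <= 2 * C / 2 ^+ N.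
  move=> zr /cexp_log[zeta ez imz]; have [D hD] := taylor_log df imz.
  (* The constant [D] depends on [z] and only identifies the limit: it disappears as [k] grows,
     leaving the uniform bound of the tail. *)
  rewrite ez in hD; apply: (@le_half_exp _ _ D) => k.
  apply: le_trans (ncDB _ (psum (coef f) (N + k.+1) z - psum (coef f) N z)) _.
  apply: lerD; first exact: (@psum_tail _ (r + 1)).
  rewrite opprB addrA subrK.
  have D0 : 0 <= D by have := hD 0%N; rewrite expr0 divr1; apply: le_trans; exact: nc_ge0.
  rewrite addnS (le_trans (hD _))// ler_wpM2l// lef_pV2 ?posrE ?exprn_gt0//.
  by rewrite ler_eXn2l ?ltr1n// leq_addl.
(* The points of the negative half-line are limits of points covered by [good]. *)
move=> z zr; have [hz|] := ltP 0 (complex.Re z).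
  by apply: good; [rewrite (le_trans zr)// lerDl|left].
have [iz _|iz _] := eqVneq (complex.Im z) 0; last first.
  by apply: good; [rewrite (le_trans zr)// lerDl|right].
pose g w := f w - psum (coef f) N w.
have cg : contC g z.
  by apply: contCB; [have [l] := df z; exact: diffC_cont|exact: psum_contC].
apply/ler_addgt0Pr => e e0; move/contCP: cg => /(_ e e0)/nbhs_ncP[d d0 hd].
pose t := Num.min 1 (d / 2).
have t0 : 0 < t by rewrite lt_min ltr01 divr_gt0.
have td : t < d by rewrite gt_min; apply/orP; right; rewrite ltr_pdivrMr// ltr_pMr// ltr1n.
pose w := z + (0 +i* t)%C.
have nt : nc (0 +i* t : R[i])%C = t.
  by rewrite /Normc.normc expr0n add0r sqrtr_sqr gtr0_norm.
have wz : nc (w - z) < d by rewrite /w addrAC subrr add0r nt.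
apply: le_trans (ncDB _ (g w)) _; apply: lerD; last first.
  by rewrite ncB ltW// hd.
apply: good; last by right; rewrite /w ImcD iz add0r gt_eqF.
rewrite (le_trans (ncD _ _))// nt lerD// ge_min lexx//.
Qed.

End Taylor.

(** * Derivatives of power series *)

Section PowerSeries.
Variable R : realType.
Implicit Types (f g : R[i] -> R[i]) (z w : R[i]) (a : nat -> R[i]) (n N : nat).

(** The intervals of radius [2 C / 2^n] around [u n] are nested. *)
Lemma real_limit (u : nat -> R) (C : R) : (forall N, `|u N.+1 - u N| <= C / 2 ^+ N) ->
  exists l, forall N, `|l - u N| <= 2 * C / 2 ^+ N.
Proof.
move=> h; have C0 : 0 <= C.
  by have := h 0%N; rewrite expr0 divr1; apply: le_trans; exact: normr_ge0.
have e n : 2 * C / 2 ^+ n.+1 = C / 2 ^+ n :> R by rewrite exprSr; field; rewrite expf_neq0.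
have [||n|l lP] := @nested_intervals R (fun n => u n - 2 * C / 2 ^+ n)
    (fun n => u n + 2 * C / 2 ^+ n).
- by move=> n; rewrite e; have := h n; rewrite ler_norml => /andP[? ?]; lra.
- by move=> n; rewrite e; have := h n; rewrite ler_norml => /andP[? ?]; lra.
- have : 0 <= 2 * C / 2 ^+ n by rewrite divr_ge0 ?mulr_ge0 ?exprn_ge0.
  lra.
exists l => N; have /andP[? ?] := lP N.
by rewrite ler_norml; apply/andP; split; lra.
Qed.

Lemma complex_limit (u : nat -> R[i]) (C : R) : (forall N, nc (u N.+1 - u N) <= C / 2 ^+ N) ->
  exists l, forall N, nc (l - u N) <= 4 * C / 2 ^+ N.
Proof.
move=> h.
have [|x hx] := @real_limit (fun n => complex.Re (u n)) C.
  by move=> N; rewrite -RecN -RecD (le_trans (Re_le_nc _)).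
have [|y hy] := @real_limit (fun n => complex.Im (u n)) C.
  by move=> N; rewrite -ImcN -ImcD (le_trans (Im_le_nc _)).
exists (x +i* y)%C => N; rewrite (le_trans (nc_le _))// RecD ImcD RecN ImcN /=.
have := hx N; have := hy N.
have -> : 4 * C / 2 ^+ N = 2 * C / 2 ^+ N + 2 * C / 2 ^+ N by field; rewrite expf_neq0.
lra.
Qed.

Lemma growth_term a z : growth a -> exists C : R, forall n, nc (a n * z ^+ n) <= C / 2 ^+ n.
Proof.
move=> ga; have [|C C0 hC] := ga (2 * (nc z + 1)).
  by rewrite mulr_gt0// ltr_wpDl// nc_ge0.
exists C => n; rewrite ler_pdivlMr ?exprn_gt0// ncM ncX; apply: le_trans (hC n).
rewrite exprMn -mulrA ler_wpM2l ?nc_ge0// mulrC ler_wpM2l ?exprn_ge0//.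
by rewrite lerXn2r ?nnegrE ?nc_ge0 ?addr_ge0 ?nc_ge0// lerDl.
Qed.

Lemma growth_expands a : growth a -> exists f, expands a f.
Proof.
move=> ga.
have /choice[f fP] : forall z, exists l, exists C : R, forall N, nc (l - psum a N z) <= C / 2 ^+ N.
  move=> z; have [C hC] := growth_term z ga.
  have [|l hl] := @complex_limit (fun N => psum a N z) C; last by exists l, (4 * C).
  by move=> N; rewrite psumS addrAC subrr add0r.
exists f; split => // r r0; have [|C C0 hC] := ga (2 * r); first by rewrite mulr_gt0.
exists (2 * C) => [|N z zr]; first by rewrite mulr_ge0.
have [D hD] := fP z; apply: (@le_half_exp _ _ _ D) => k.
apply: le_trans (ncDB _ (psum a (N + k) z - psum a N z)) _.
apply: lerD; first exact: (@psum_tail _ _ r).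
rewrite opprB addrA subrK.
have D0 : 0 <= D by have := hD 0%N; rewrite expr0 divr1; apply: le_trans; exact: nc_ge0.
rewrite (le_trans (hD _))// ler_wpM2l// lef_pV2 ?posrE ?exprn_gt0//.
by rewrite ler_eXn2l ?ltr1n// leq_addl.
Qed.

Definition dcoef a n := n.+1%:R * a n.+1.

Lemma growth_dcoef a : growth a -> growth (dcoef a).
Proof.
move=> ga r r0; have [|C C0 hC] := ga (2 * r); first by rewrite mulr_gt0.
exists (C / r) => [|n]; first by rewrite divr_ge0// ltW.
rewrite ler_pdivlMr// -mulrA -exprSr /dcoef ncM nc_nat.
apply: le_trans (hC n.+1); rewrite mulrAC mulrC ler_wpM2l ?nc_ge0//.
rewrite exprMn ler_wpM2r ?exprn_ge0 ?(ltW r0)//.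
by rewrite -natrX ler_nat ltnW// ltn_expl.
Qed.

(** The difference quotient of [psum a N.+1] between [z] and [w], expanded as a polynomial so that
    it is defined and continuous at [w = z] too. *)
Definition dquot a z N w : R[i] :=
  \sum_(n < N) a n.+1 * \sum_(i < n.+1) w ^+ (n - i) * z ^+ i.

Lemma dquotE a z N w : psum a N.+1 w - psum a N.+1 z = dquot a z N w * (w - z).
Proof.
rewrite /psum !big_ord_recl !expr0 !mulr1 opprD addrACA subrr add0r.
rewrite -sumrB /dquot mulr_suml; apply: eq_bigr => n _.
by rewrite -mulrBr subrXX -mulrA [_ * (w - z)]mulrC.
Qed.

Lemma dquot_diag a z N : dquot a z N z = psum (dcoef a) N z.
Proof.
apply: eq_bigr => n _; rewrite /dcoef [_%:R * _]mulrC -mulrA; congr (_ * _).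
rewrite (eq_bigr (fun=> z ^+ n)) => [|i _].
  by rewrite sumr_const card_ord mulr_natl.
by rewrite -exprD subnK// -ltnS.
Qed.

Lemma dquot_contC a z N w : contC (dquot a z N) w.
Proof.
apply: contCsum => n; apply: contCM; first exact: contCst.
apply: contCsum => i; apply: contCM; last exact: contCst.
by apply: contCX; exact: contCid.
Qed.

Lemma dquot_tail a (r C : R) z w N k : nc z <= r -> nc w <= r ->
  (forall n, nc (dcoef a n) * (2 * r) ^+ n <= C) ->
  nc (dquot a z (N + k) w - dquot a z N w) <= 2 * C / 2 ^+ N.
Proof.
move=> zr wr hC.
apply: (@sum_tail _ (fun n => a n.+1 * \sum_(i < n.+1) w ^+ (n - i) * z ^+ i)) => n.
rewrite ler_pdivlMr ?exprn_gt0//; apply: le_trans (hC n).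
have r0 := le_trans (nc_ge0 z) zr.
rewrite /dcoef !ncM nc_nat exprMn.
have : nc (\sum_(i < n.+1) w ^+ (n - i) * z ^+ i) <= n.+1%:R * r ^+ n.
  apply: le_trans (nc_sum _ _) _.
  rewrite -[n.+1 in leRHS]card_ord -sumr_const mulr_suml; apply: ler_sum => i _.
  rewrite mul1r -[X in r ^+ X](@subnK i) ?exprD; last by rewrite -ltnS.
  by rewrite ncM !ncX ler_pM ?exprn_ge0 ?nc_ge0// lerXn2r ?nnegrE ?nc_ge0.
move=> h; rewrite [_ * nc (a _)]mulrC -!mulrA ler_wpM2l ?nc_ge0//.
by rewrite [2 ^+ n * _]mulrC mulrA ler_wpM2r ?exprn_ge0.
Qed.

(** The Carathéodory quotient of [f] at [z] is a uniform limit, on a disc, of the polynomials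
    [dquot a z N]; hence it is continuous. *)
Lemma expands_derive a f : expands a f ->
  exists g, expands (dcoef a) g /\ forall z, diffC f z (g z).
Proof.
move=> [ga fa]; have gd := growth_dcoef ga; have [g eg] := growth_expands gd.
exists g; split => // z.
have r0 : 0 < nc z + 1 by rewrite ltr_wpDl// nc_ge0.
have zr : nc z <= nc z + 1 by rewrite lerDl.
set r := nc z + 1 in r0 zr.
have [|C C0 hC] := gd (2 * r); first by rewrite mulr_gt0.
have [B B0 hB] := fa r r0; have [B' B'0 hB'] := eg.2 r r0.
pose q w := if w == z then g z else (f w - f z) / (w - z).
(* Dividing the truncation errors of [f] by [w - z] gives a constant that blows up as [w] tends to
   [z]. It serves only to identify the limit; the rate, uniform in [w], is that of [dquot_tail]. *)
have qN w N : nc w <= r -> nc (q w - dquot a z N w) <= 2 * C / 2 ^+ N.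
  move=> wr.
  have [D [D0 hD]] : exists D, 0 <= D /\ forall N, nc (q w - dquot a z N w) <= D / 2 ^+ N.
    rewrite /q; have [->|wz] := eqVneq w z.
      by exists B'; split => // n; rewrite dquot_diag hB'.
    have wz0 : 0 < nc (w - z) by rewrite nc_gt0 subr_eq0.
    exists (2 * B / nc (w - z)); split; first by rewrite divr_ge0 ?mulr_ge0// ltW.
    move=> n.
    have -> : (f w - f z) / (w - z) - dquot a z n w =
        ((f w - psum a n.+1 w) - (f z - psum a n.+1 z)) / (w - z).
      have wz1 : w - z != 0 by rewrite subr_eq0.
      by rewrite -[dquot a z n w](mulfK wz1) -dquotE -mulrBl; congr (_ / _); ring.
    rewrite ncM ncV mulrAC ler_wpM2r ?invr_ge0 ?nc_ge0//.
    apply: le_trans (ncD _ _) _; rewrite ncN mulr_natl mulr2n mulrDl.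
    have le n' : B / 2 ^+ n'.+1 <= B / 2 ^+ n'.
      by rewrite ler_wpM2l// lef_pV2 ?posrE ?exprn_gt0// ler_eXn2l ?ltr1n.
    by apply: lerD; apply: le_trans (le n); apply: hB.
  apply: (@le_half_exp _ _ _ D) => k.
  apply: le_trans (ncDB _ (dquot a z (N + k) w - dquot a z N w)) _.
  apply: lerD; first exact: (@dquot_tail _ r).
  rewrite opprB addrA subrK.
  rewrite (le_trans (hD _))// ler_wpM2l// lef_pV2 ?posrE ?exprn_gt0//.
  by rewrite ler_eXn2l ?ltr1n// leq_addl.
have <- : q z = g z by rewrite /q eqxx.
apply: diffC_local.
  apply/contCP => e e0; have e3 : 0 < e / 3 by rewrite divr_gt0.
  have [N hN] := exists_half_exp (2 * C) e3.
  have /contCP/(_ _ e3)/nbhs_ncP[d d0 hd] := dquot_contC a z N z.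
  apply/nbhs_ncP; exists (Num.min 1 d); first by rewrite lt_min ltr01.
  move=> w; rewrite lt_min => /andP[w1 wd].
  have wr : nc w <= r by rewrite (le_trans (ncDB _ z))// lerD2l ltW.
  have h1 := qN w N wr; have h2 := qN z N zr; have h3 := hd w wd.
  have -> : q w - q z = (q w - dquot a z N w) + (dquot a z N w - dquot a z N z)
      - (q z - dquot a z N z) by ring.
  rewrite (le_lt_trans (ncD _ _))// ncN.
  have := ncD (q w - dquot a z N w) (dquot a z N w - dquot a z N z).
  lra.
near=> w; rewrite /q; case: eqP => [->|/eqP wz]; first by rewrite !subrr mulr0.
by rewrite divfK// subr_eq0.
Unshelve. all: by end_near. Qed.

Lemma expands0 a f : expands a f -> f 0 = a 0%N.
Proof.
move=> [_ fa]; have [B B0 hB] := fa 1 ltr01.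
apply/eqP; rewrite -subr_eq0 -nc_eq0 eq_le nc_ge0 andbT.
apply: (@le_half_exp _ _ _ B) => n; rewrite add0r.
have := hB n.+1 0; rewrite nc0 ler01 => /(_ isT).
have -> : psum a n.+1 0 = a 0%N.
  by rewrite /psum big_ord_recl expr0 mulr1 big1 ?addr0// => i _; rewrite expr0n mulr0.
move=> /le_trans; apply.
by rewrite ler_wpM2l// lef_pV2 ?posrE ?exprn_gt0// ler_eXn2l ?ltr1n.
Qed.

Lemma expands_derive1n a f n : expands a f -> derive1n n f 0 = n`!%:R * a n.
Proof.
elim: n a f => [|n IH] a f fa; first by rewrite fact0 mul1r -(expands0 fa).
have [g [eg dg]] := expands_derive fa.
rewrite derive1Sn (derive1_entire dg) (IH _ _ eg) /dcoef factS natrM.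
by rewrite mulrA [_%:R * n.+1%:R]mulrC.
Qed.

Theorem entire_expands f : is_entire f -> expands (taylor_coef f) f.
Proof.
move=> /is_entireP df; have e := expands_coef (fun w => ex_intro _ _ (df w)).
suff -> : taylor_coef f = coef f by [].
apply/funext => n; rewrite /taylor_coef (expands_derive1n n e) mulrC mulKf//.
Qed.

End PowerSeries.

(** * Density of exponential sums *)

Section ExpSums.
Variable R : realType.
Implicit Types (f g : R[i] -> R[i]) (z w l : R[i]) (s : seq (R[i] * R[i])) (n N : nat).

Definition expsum s z : R[i] := \sum_(p <- s) p.1 * cexp (p.2 * z).

Lemma expsum_cons p s z : expsum (p :: s) z = p.1 * cexp (p.2 * z) + expsum s z.
Proof. by rewrite /expsum big_cons. Qed.

Lemma expsum_nil z : expsum [::] z = 0.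
Proof. by rewrite /expsum big_nil. Qed.

Lemma expsum_cat s t z : expsum (s ++ t) z = expsum s z + expsum t z.
Proof. by rewrite /expsum big_cat. Qed.

Lemma expsum_diff s z : diffC (expsum s) z (expsum [seq (p.1 * p.2, p.2) | p <- s] z).
Proof.
elim: s => [|p s IH].
  rewrite expsum_nil (_ : expsum [::] = fun=> 0); first exact: diffC_cst.
  by apply/funext => w; rewrite expsum_nil.
rewrite (_ : expsum (p :: s) = fun w => p.1 * cexp (p.2 * w) + expsum s w); last first.
  by apply/funext => w; rewrite expsum_cons.
rewrite /= expsum_cons /=; apply: diffC_add => //.
have d1 := diffC_mul (diffC_cst p.2 z) (diffC_id z).
have := diffC_mul (diffC_cst p.1 z) (diffC_comp d1 (diffC_cexp _)).
by congr diffC; ring.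
Qed.

Lemma expsum_entire s : is_entire (expsum s).
Proof. by apply: is_entireW => z; exact: expsum_diff. Qed.

Lemma expsum_derive1n n s : derive1n n (expsum s) = expsum [seq (p.1 * p.2 ^+ n, p.2) | p <- s].
Proof.
elim: n s => [|n IH] s.
  by rewrite (eq_map (g := id)) ?map_id// => -[a b] /=; rewrite mulr1.
rewrite derive1Sn (derive1_entire (expsum_diff s)) IH -map_comp; congr expsum.
by apply: eq_map => p /=; rewrite exprS mulrA.
Qed.

(** A substitute for multiplication by [z] that maps exponential sums to exponential sums. *)
Definition dquo (h : R) z : R[i] := (cexp (h%:C%C * z) - 1) / h%:C%C.

Lemma dquo_close (h r : R) z : 0 < h -> h * r <= 1 / 2 -> nc z <= r ->
  nc (dquo h z - z) <= 9 * h * r ^+ 2.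
Proof.
move=> h0 hr zr; have hc : h%:C%C != 0 :> R[i] by rewrite -nc_eq0 nc_real normr_eq0 gt_eqF.
have nh : nc (h%:C%C : R[i]) = h by rewrite nc_real gtr0_norm.
have -> : dquo h z - z = (cexp (h%:C%C * z) - 1 - h%:C%C * z) / h%:C%C.
  by rewrite /dquo; field.
rewrite ncM ncV nh ler_pdivrMr//.
have hz : nc (h%:C%C * z) <= h * r by rewrite ncM nh ler_pM2l.
apply: le_trans (nc_cexpB1D_le (le_trans hz hr)) _.
have : nc (h%:C%C * z) ^+ 2 <= (h * r) ^+ 2.
  by rewrite lerXn2r ?nnegrE ?nc_ge0// (le_trans (nc_ge0 _) hz).
by rewrite exprMn => ?; nra.
Qed.

Lemma dquoX_close (r : R) k : 0 < r -> exists2 D, 0 <= D & forall h z,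
  0 < h -> h * r <= 1 / 2 -> 9 * h * r ^+ 2 <= 1 -> nc z <= r ->
  nc (dquo h z ^+ k - z ^+ k) <= h * D.
Proof.
move=> r0; elim: k => [|k [D D0 IH]].
  by exists 0 => // h z *; rewrite !expr0 subrr nc0 mulr0.
exists ((r + 1) * D + 9 * r ^+ 2 * r ^+ k).
  by rewrite addr_ge0 ?mulr_ge0 ?exprn_ge0 ?addr_ge0// ltW.
move=> h z h0 h1 h2 zr; have hc := dquo_close h0 h1 zr.
have -> : dquo h z ^+ k.+1 - z ^+ k.+1 =
    dquo h z * (dquo h z ^+ k - z ^+ k) + (dquo h z - z) * z ^+ k by rewrite !exprS; ring.
apply: le_trans (ncD _ _) _; rewrite [nc (dquo h z * _)]ncM [nc (_ * z ^+ k)]ncM ncX.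
have -> : h * ((r + 1) * D + 9 * r ^+ 2 * r ^+ k) = (r + 1) * (h * D) + 9 * h * r ^+ 2 * r ^+ k.
  by ring.
apply: lerD; apply: ler_pM; rewrite ?nc_ge0 ?exprn_ge0 ?nc_ge0//.
- by rewrite (le_trans (ncDB _ z))// lerD// (le_trans hc).
- exact: IH.
- by rewrite lerXn2r ?nnegrE ?nc_ge0// ltW.
Qed.

Lemma dquo_expsum (h d : R) l s : 0 < h ->
  (forall p, p \in s -> nc (p.2 - l) <= d) -> exists2 t,
    (forall p, p \in t -> nc (p.2 - l) <= d + h) &
    forall z, dquo h z * expsum s z = expsum t z.
Proof.
move=> h0; have hc : h%:C%C != 0 :> R[i] by rewrite -nc_eq0 nc_real normr_eq0 gt_eqF.
elim: s => [|p s IH] hs.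
  by exists [::] => // z; rewrite !expsum_nil mulr0.
have [|t ht et] := IH; first by move=> q qs; apply: hs; rewrite inE qs orbT.
exists ((p.1 / h%:C%C, p.2 + h%:C%C) :: (- p.1 / h%:C%C, p.2) :: t).
  move=> q; rewrite !inE => /or3P[/eqP->|/eqP->|/ht//] /=; have hp := hs p (mem_head _ _).
    by rewrite addrAC (le_trans (ncD _ _))// nc_real gtr0_norm// lerD.
  by rewrite (le_trans hp)// lerDl ltW.
move=> z; rewrite !expsum_cons mulrDr -et addrA /=; congr (_ + _).
by rewrite mulrDl cexpD /dquo; field.
Qed.

Lemma dquoX_expsum (h : R) l k : 0 < h -> exists2 t,
    (forall p, p \in t -> nc (p.2 - l) <= k%:R * h) &
    forall z, dquo h z ^+ k * cexp (l * z) = expsum t z.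
Proof.
move=> h0; elim: k => [|k [s hs es]].
  exists [:: (1, l)] => [p|z]; last by rewrite expsum_cons expsum_nil addr0.
  by rewrite inE => /eqP -> /=; rewrite subrr nc0 mul0r.
have [t ht et] := dquo_expsum h0 hs; exists t.
  by move=> p /ht; rewrite -natr1 mulrDl mul1r.
by move=> z; rewrite exprS -mulrA es et.
Qed.

(** Membership in the closure, in H(C), of the span of the exponentials with frequencies in the open
    disc of centre [l] and radius [d]. *)
Definition expapprox l (d : R) f := forall r e : R, 0 < r -> 0 < e ->
  exists2 s, (forall p, p \in s -> nc (p.2 - l) < d) &
    forall z, nc z <= r -> nc (f z - expsum s z) <= e.

Lemma nc_cexp_le l z (r : R) : nc z <= r -> nc (cexp (l * z)) <= expR (nc l * r).
Proof.
move=> zr; rewrite nc_cexp ler_expR (le_trans (ler_norm _))// (le_trans (Re_le_nc _))//.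
by rewrite ncM ler_wpM2l ?nc_ge0.
Qed.

Lemma expapproxD l d f g : expapprox l d f -> expapprox l d g ->
  expapprox l d (fun z => f z + g z).
Proof.
move=> hf hg r e r0 e0; have e2 : 0 < e / 2 by rewrite divr_gt0.
have [s hs es] := hf r _ r0 e2; have [t ht et] := hg r _ r0 e2.
exists (s ++ t) => [p|z zr]; first by rewrite mem_cat => /orP[/hs|/ht].
rewrite expsum_cat opprD addrACA [leRHS]splitr (le_trans (ncD _ _))// lerD ?es ?et//.
Qed.

Lemma expapproxZ l d c f : expapprox l d f -> expapprox l d (fun z => c * f z).
Proof.
move=> hf r e r0 e0.
have c0 : 0 < nc c + 1 by rewrite ltr_wpDl// nc_ge0.
have [|s hs es] := hf r (e / (nc c + 1)) r0; first by rewrite divr_gt0.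
exists [seq (c * p.1, p.2) | p <- s] => [_ /mapP[p ps ->]|z zr]; first exact: (hs p ps).
have -> : expsum [seq (c * p.1, p.2) | p <- s] z = c * expsum s z.
  by rewrite /expsum big_map mulr_sumr; apply: eq_bigr => p _; rewrite mulrA.
rewrite -mulrBr ncM; have := es z zr; rewrite ler_pdivlMr// => h.
rewrite (le_trans _ h)// mulrC ler_wpM2l ?nc_ge0// lerDl//.
Qed.

Lemma expapprox_monomial l d k : 0 < d -> expapprox l d (fun z => z ^+ k * cexp (l * z)).
Proof.
move=> d0 r e r0 e0; have [D D0 hD] := dquoX_close k r0.
pose E := expR (nc l * r).
have E0 : 0 < E by exact: expR_gt0.
(* The first two bounds are those of [dquoX_close], the third keeps [k] shifts by [h] below [d], and
   the last absorbs the size [E] of [e^(l z)] on the disc. *)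
pose h := Num.min (Num.min (1 / 2 / r) (1 / (9 * r ^+ 2)))
  (Num.min (d / (2 * k.+1%:R)) (e / (E * (D + 1)))).
have D1 : 0 < D + 1 by rewrite ltr_wpDl.
have r2 : 0 < 9 * r ^+ 2 by rewrite mulr_gt0// exprn_gt0.
have kd : 0 < 2 * k.+1%:R :> R by rewrite mulr_gt0.
have h0 : 0 < h by rewrite /h !lt_min !divr_gt0 ?mulr_gt0.
have : h <= h by []; rewrite {2}/h !le_min => /andP[/andP[h1 h2] /andP[h3 h4]].
have [s hs es] := dquoX_expsum l k h0.
exists s => [p /hs|z zr].
  move=> /le_lt_trans; apply.
  move: h3; rewrite ler_pdivlMr// -natr1 => h3.
  have k0 : 0 <= k%:R :> R by [].
  nra.
rewrite -es -mulrBl ncM ncB.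
rewrite ler_pdivlMr// in h1; rewrite ler_pdivlMr// in h2; rewrite ler_pdivlMr ?mulr_gt0// in h4.
have a1 : 9 * h * r ^+ 2 <= 1 by rewrite mulrAC mulrC.
have := hD h z h0 h1 a1 zr; have := nc_cexp_le l zr; rewrite -/E => a2 a3.
apply: le_trans (ler_pM (nc_ge0 _) (nc_ge0 _) a3 a2) _.
apply: le_trans h4; rewrite mulrAC -mulrA ler_pM2l// ler_pM2l// lerDl//.
Qed.

Lemma expapprox_psum a l d N : 0 < d -> expapprox l d (fun z => psum a N z * cexp (l * z)).
Proof.
move=> d0; elim: N => [|N IH].
  move=> r e r0 e0; exists [::] => // z _.
  by rewrite expsum_nil /psum big_ord0 mul0r subrr nc0 ltW.
rewrite (_ : (fun z => _) = fun z => psum a N z * cexp (l * z) + a N * (z ^+ N * cexp (l * z))).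
  by apply: expapproxD => //; apply: expapproxZ; exact: expapprox_monomial.
by apply/funext => z; rewrite psumS mulrDl mulrA.
Qed.

(** Expanding [f(z) e^(- l z)] rather than [f] recentres the frequencies at [l]: the truncated
    series times [e^(l z)] is a combination of the functions [z^k e^(l z)]. *)
Theorem entire_expapprox f l d : is_entire f -> 0 < d -> expapprox l d f.
Proof.
move=> /is_entireP ef d0 r e r0 e0.
pose g z := f z * cexp (- l * z).
have eg : is_entire g.
  have dg z : exists m, diffC g z m.
    have d1 := diffC_mul (diffC_cst (- l) z) (diffC_id z).
    have := diffC_mul (ef z) (diffC_comp d1 (diffC_cexp _)).
    by set k := (X in diffC _ _ X) => h; exists k.
  by move=> z; have [m] := dg z; exact: diffC_derivable.
have [_ /(_ r r0)[B B0 hB]] := entire_expands eg.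
have E0 := expR_gt0 (nc l * r); have e2 : 0 < e / 2 by rewrite divr_gt0.
have [N hN] := exists_half_exp (B * expR (nc l * r)) e2.
have [s hs es] := expapprox_psum (taylor_coef g) l N d0 r0 e2.
exists s => // z zr; apply: le_trans (ncDB _ (psum (taylor_coef g) N z * cexp (l * z) - expsum s z)) _.
rewrite [leRHS]splitr; apply: lerD; first exact: es.
rewrite opprB addrA subrK.
have -> : f z = g z * cexp (l * z).
  by rewrite /g -mulrA -cexpD mulNr addNr cexp0 mulr1.
rewrite -mulrBl ncM (le_trans _ (ltW hN))//.
apply: le_trans (ler_pM (nc_ge0 _) (nc_ge0 _) (hB N z zr) (nc_cexp_le l zr)) _.
by rewrite mulrAC.
Qed.

End ExpSums.

(** * The space of entire functions *)

Section Topology.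
Variable R : realType.
Implicit Types (z w l : R[i]) (s : seq (R[i] * R[i])) (n N : nat).

Lemma entourage_nc (E : set (R[i] * R[i])) : entourage E ->
  exists2 e : R, 0 < e & forall x y, nc (x - y) < e -> E (x, y).
Proof.
rewrite -entourage_ballE => -[[e e'] /= + h]; rewrite ltcE /= => /andP[/eqP e'0 e0].
exists e => // x y xy; apply: h => /=.
rewrite /ball /= -[`|_|]/((nc _)%:C)%C.
by rewrite e'0 complexr0 ltcR.
Qed.

Lemma compact_nc_le (K : set R[i]) : compact K ->
  exists2 r : R, 0 < r & forall z, K z -> nc z <= r.
Proof.
move=> cK; have cn : {within K, continuous (fun z : R[i] => nc z)}.
  by apply: continuous_subspaceT => z; apply: nc_contC; exact: contCid.
have /compact_bounded[M [_ /(_ (`|M| + 1))]] := continuous_compact cn cK.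
rewrite (le_lt_trans (ler_norm _)) ?ltrDl// => /(_ isT) hM.
exists (`|M| + 1) => [|z Kz]; first by rewrite ltr_wpDl.
by rewrite (le_trans (ler_norm _))//; apply: hM; exists z.
Qed.

Lemma cvg_family (u : nat -> R[i] -> R[i]) (g : R[i] -> R[i]) :
  (forall r e : R, 0 < r -> 0 < e -> exists N, forall n, (N <= n)%N ->
    forall z, nc z <= r -> nc (u n z - g z) < e) ->
  {family compact, u @ \oo --> g}.
Proof.
move=> h; apply/fam_cvgP => K /compact_nc_le[r r0 Kr] P /uniform_nbhs[E [/entourage_nc[e e0 eE] hP]].
have [N hN] := h r e r0 e0.
exists N => // n /= Nn; apply: hP => z /Kr zr; apply: eE.
by rewrite ncB; exact: hN.
Qed.

Lemma family_cvg (u : nat -> R[i] -> R[i]) (g : R[i] -> R[i]) z (e : R) :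
  {family compact, u @ \oo --> g} -> 0 < e ->
  \forall n \near \oo, nc (u n z - g z) < e.
Proof.
move=> /fam_cvgP/(_ [set z] (@compact_set1 _ z)).
rewrite uniform_set1 => h e0.
apply: (h [set y | nc (y - g z) < e]).
by apply/nbhs_ncP; exists e.
Qed.

Lemma entire_ext (f g : entire R) : (forall z, f z = g z) -> f = g.
Proof. by move=> h; apply: val_inj; apply/funext. Qed.

(** A single [r] governs both the disc and the tolerance. If none worked, functions [g n] outside
    [U] satisfying the condition for [n + 1] would converge to [f], against the openness of [U]. *)
Lemma open_entire_ball (U : set (entire R)) (f : entire R) : open U -> U f ->
  exists2 r : R, 0 < r & forall g : entire R,
    (forall z, nc z <= r -> nc (f z - g z) <= r^-1) -> U g.
Proof.
move=> oU Uf; apply: contrapT => H.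
have /choice[g gP] : forall n, exists g : entire R,
    (forall z, nc z <= n.+1%:R -> nc (f z - g z) <= n.+1%:R^-1) /\ ~ U g.
  move=> n; apply: contrapT => h; apply: H; exists n.+1%:R => // g gP.
  by apply: contrapT => Ug; apply: h; exists g.
have [V oV VU] : exists2 V : set {family compact, R[i] -> R[i]}, open V &
    (fun f : entire R => (f : R[i] -> R[i])) @^-1` V = U.
  case: oU => V oV <-; by exists V.
have : {family compact, (fun n => (g n : R[i] -> R[i])) @ \oo --> (f : R[i] -> R[i])}.
  apply: cvg_family => r e r0 e0.
  pose N := Num.bound (r + e^-1).
  have hN : r + e^-1 < N%:R by apply: archi_boundP; rewrite addr_ge0 ?invr_ge0// ltW.
  exists N => n Nn z zr; rewrite ncB.
  have ei : 0 < e^-1 by rewrite invr_gt0.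
  have nN : N%:R <= n.+1%:R :> R by rewrite ler_nat ltnW.
  apply: le_lt_trans ((gP n).1 z _) _; first lra.
  by rewrite invf_plt ?posrE//; lra.
move=> /(_ V)[|N _ hN]; first by apply: open_nbhs_nbhs; split => //; move: Uf; rewrite -VU.
apply: (gP N).2; rewrite -VU; exact: (hN N (leqnn N)).
Qed.

Definition mk_entire (f : R[i] -> R[i]) (hf : is_entire f) : entire R :=
  SigSub (mem_set hf
    : f \in ([set f | is_entire f] : set {family compact, R[i] -> R[i]})).

Definition expsumE s : entire R := mk_entire (@expsum_entire R s).

Lemma expsumE_val s z : expsumE s z = expsum s z.
Proof. by []. Qed.

Lemma op_phiD_expsum (phi : R[i] -> R[i]) s : is_entire phi ->
  op_phiD phi (expsumE s) = expsumE [seq (p.1 * phi p.2, p.2) | p <- s].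
Proof.
move=> ephi.
pose u N z := \sum_(n < N) taylor_coef phi n * derive1n n (expsumE s) z.
have uE N z : u N z = \sum_(p <- s) p.1 * cexp (p.2 * z) * psum (taylor_coef phi) N p.2.
  rewrite /u /psum; under eq_bigr do rewrite expsum_derive1n /expsum big_map mulr_sumr.
  rewrite exchange_big /=; apply: eq_bigr => p _; rewrite mulr_sumr.
  by apply: eq_bigr => n _ /=; ring.
have cvu : {family compact, u @ \oo --> expsum [seq (p.1 * phi p.2, p.2) | p <- s]}.
  apply: cvg_family => r e r0 e0.
  have [D [D0 hD]] : exists D : R, 0 <= D /\ forall N z, nc z <= r ->
      nc (u N z - expsum [seq (p.1 * phi p.2, p.2) | p <- s] z) <= D / 2 ^+ N.
    have : exists D : R, 0 <= D /\ forall N z, nc z <= r ->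
      nc (\sum_(p <- s) p.1 * cexp (p.2 * z) * psum (taylor_coef phi) N p.2 -
          expsum [seq (p.1 * phi p.2, p.2) | p <- s] z) <= D / 2 ^+ N.
      elim: s {u uE} => [|p s [D [D0 hD]]].
        by exists 0; split => // N z _; rewrite expsum_nil big_nil subrr nc0 mul0r.
      have l0 : 0 < nc p.2 + 1 by rewrite ltr_wpDl// nc_ge0.
      have [_ /(_ _ l0)[B B0 hB]] := entire_expands ephi.
      exists (nc p.1 * expR (nc p.2 * r) * B + D); split.
        by rewrite addr_ge0// !mulr_ge0// ?nc_ge0// expR_ge0.
      move=> N z zr; rewrite big_cons /= expsum_cons /= opprD addrACA mulrDl.
      apply: le_trans (ncD _ _) _; apply: lerD; last exact: hD.
      have -> : p.1 * cexp (p.2 * z) * psum (taylor_coef phi) N p.2 - p.1 * phi p.2 * cexp (p.2 * z)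
        = - (p.1 * cexp (p.2 * z) * (phi p.2 - psum (taylor_coef phi) N p.2)) by ring.
      rewrite ncN !ncM -!mulrA ler_wpM2l ?nc_ge0//.
      by rewrite ler_pM ?nc_ge0// ?nc_cexp_le// hB// lerDl.
    by move=> [D [D0 hD]]; exists D; split => // N z zr; rewrite uE hD.
  have [N hN] := exists_half_exp D e0; exists N => n Nn z zr.
  apply: le_lt_trans (hD _ _ zr) _; apply: le_lt_trans hN.
  by rewrite ler_wpM2l// lef_pV2 ?posrE ?exprn_gt0// ler_eXn2l ?ltr1n.
(* A limit has been exhibited, so [get] returns some limit; comparing values at each point shows
   that it is the same one. *)
have cvg : {family compact, u @ \oo --> (op_phiD phi (expsumE s) : R[i] -> R[i])}.
  rewrite /op_phiD; set S := [set g | _].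
  have : S (get S) by apply: getPex; exists (expsumE [seq (p.1 * phi p.2, p.2) | p <- s]).
  by [].
apply: entire_ext => z; apply/eqP; rewrite -subr_eq0 -nc_eq0 eq_le nc_ge0 andbT leNgt.
apply/negP => J0; set J := nc _ in J0; have J2 : 0 < J / 2 by rewrite divr_gt0.
have [n [h1 h2]] : exists n, nc (u n z - op_phiD phi (expsumE s) z) < J / 2 /\
    nc (u n z - expsumE [seq (p.1 * phi p.2, p.2) | p <- s] z) < J / 2.
  have [N _ hN] := family_cvg z cvg J2; have [N' _ hN'] := family_cvg z cvu J2.
  by exists (maxn N N'); split; [apply: hN|apply: hN']; rewrite /= ?leq_maxl ?leq_maxr.
have : J <= nc (u n z - op_phiD phi (expsumE s) z) +
    nc (u n z - expsumE [seq (p.1 * phi p.2, p.2) | p <- s] z).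
  rewrite [X in _ <= X + _]ncB; apply: le_trans (ncD _ _).
  by rewrite addrA subrK.
lra.
Qed.

End Topology.

(** * Visits of an ergodic transformation *)

Section Ergodic.
Variable R : realType.
Local Notation mu := (@lebesgue_measure R).
Local Notation C := (circle R).
Variable tau : R -> R.
Hypothesis tau_mp : measure_preserving tau.
Implicit Types (A B : set R) (w : R) (n k : nat).

Lemma measurable_circle : measurable C.
Proof. exact: measurable_itv. Qed.

Lemma measure_circle : mu C = 1%E.
Proof. by rewrite /circle lebesgue_measure_itv/= lte_fin ltr01 sube0. Qed.

Lemma circle_lty : (mu C < +oo)%E.
Proof. by rewrite measure_circle ltry. Qed.

Lemma tau_circle w : C w -> C (tau w).
Proof. by case: tau_mp => h _ _; exact: h. Qed.

Lemma iter_circle n w : C w -> C (iter n tau w).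
Proof. by move=> Cw; elim: n => //= n; exact: tau_circle. Qed.

(** The intersection with the circle is essential, [tau] being arbitrary outside it. *)
Definition pre n A := C `&` iter n tau @^-1` A.

Lemma preS n A : pre n.+1 A = C `&` tau @^-1` pre n A.
Proof.
apply/seteqP; split => w [Cw]; rewrite /pre /= -iterS iterSr.
  by move=> h; split => //; split => //; exact: tau_circle.
by move=> [_ h].
Qed.

Lemma pre_measure n A : measurable A -> A `<=` C ->
  measurable (pre n A) /\ mu (pre n A) = mu A.
Proof.
move=> mA AC; elim: n => [|n [mp ep]].
  by rewrite /pre /= (_ : C `&` _ = A)//; exact/setIidr.
case: tau_mp => _ mt pt; rewrite preS; split.
  by apply: mt => //; exact: measurable_circle.
by rewrite pt// => w [].
Qed.

Definition visits A n w : R := \sum_(j < n) \1_A (iter j tau w).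

Lemma visits0 A w : visits A 0 w = 0.
Proof. by rewrite /visits big_ord0. Qed.

Lemma visits_add A n k w : visits A (n + k) w = visits A n w + visits A k (iter n tau w).
Proof.
rewrite /visits big_split_ord /=; congr (_ + _).
by apply: eq_bigr => i _; rewrite /= addnC iterD.
Qed.

Lemma visitsS A n w : visits A n.+1 w = \1_A w + visits A n (tau w).
Proof. by rewrite -add1n visits_add /= {1}/visits big_ord1. Qed.

Lemma indic01 A w : 0 <= (\1_A w : R) <= 1.
Proof. by rewrite indicE; case: (w \in A) => /=; rewrite ?lexx ?ler01. Qed.

Lemma visits_ge0 A n w : 0 <= visits A n w.
Proof. by apply: sumr_ge0 => j _; case/andP: (indic01 A (iter j tau w)). Qed.

Lemma visits_le A B n w : A `<=` B -> visits A n w <= visits B n w.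
Proof.
move=> AB; apply: ler_sum => j _; rewrite !indicE ler_nat.
by case: (boolP (_ \in A)) => // /set_mem/AB/mem_set ->.
Qed.

Lemma visitsE A n w : C w -> visits A n w = \sum_(j < n) \1_(pre j A) w.
Proof.
move=> Cw; apply: eq_bigr => j _; rewrite !indicE; congr (_%:R).
congr (nat_of_bool _); apply/idP/idP => /set_mem h; apply/mem_set.
  by split.
by case: h.
Qed.

Lemma measurable_visits_gt A n (c : R) : measurable A -> A `<=` C ->
  measurable [set w | C w /\ c < visits A n w].
Proof.
move=> mA AC.
have mf : measurable_fun setT (fun w => \sum_(j < n) (\1_(pre j A) w : R)).
  by apply: measurable_sum => j; apply: measurable_indic; case: (pre_measure j mA AC).
rewrite (_ : [set _ | _] = C `&` (setT `&` (fun w => \sum_(j < n) (\1_(pre j A) w : R)) @^-1` `]c, +oo[)).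
  apply: measurableI; first exact: measurable_circle.
  by apply: mf => //; exact: measurable_itv.
apply/seteqP; split => w /= [Cw].
  by move=> h; split => //; split => //; rewrite in_itv /= andbT -visitsE.
by move=> [_]; rewrite in_itv /= andbT -visitsE.
Qed.

Lemma integral_visits A n : measurable A -> A `<=` C ->
  (\int[mu]_(w in C) (visits A n w)%:E = n%:R%:E * mu A)%E.
Proof.
move=> mA AC.
under eq_integral => w wC.
  rewrite visitsE; last by move: wC => /set_mem.
  rewrite -sumEFin; over.
rewrite ge0_integral_sum//; [|exact: measurable_circle|..].
- rewrite (eq_bigr (fun=> mu A)) => [|j _]; last first.
    have [mp <-] := pre_measure j mA AC.
    by rewrite integral_indic//; [rewrite setIidl// => w []|exact: measurable_circle].
  rewrite sumr_const card_ord.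
  by rewrite mule_natl.
- move=> j; apply/measurable_EFinP; apply: measurable_indic.
  by case: (pre_measure j mA AC).
Qed.

(* An orbit of length [L] splits into blocks of length at most [M]: from a
   point outside [E] a block on which [A] has frequency at least [c], from a
   point of [E] a single step; only the last, incomplete block is lost. *)
Lemma visits_block A E (c : R) M : 0 <= c -> c <= 1 ->
  (forall w, C w -> ~ E w -> exists n, [/\ (0 < n)%N, (n <= M)%N & c * n%:R <= visits A n w]) ->
  forall L w, C w -> c * (L%:R - M%:R) <= visits (A `|` E) L w.
Proof.
move=> c0 c1 h; elim/ltn_ind => L IH w Cw.
have [LM|ML] := leqP L M.
  apply: le_trans (visits_ge0 _ _ _); rewrite mulr_ge0_le0// subr_le0 ler_nat//.
have [Ew|/(h w Cw)[n [n0 nM hn]]] := pselect (E w).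
  case: L ML IH => // L ML IH; rewrite visitsS.
  have := IH L (ltnSn L) (tau w) (tau_circle Cw).
  rewrite indicE mem_set; last by right.
  by rewrite -natr1 /=; lra.
have nL : (n <= L)%N by rewrite (leq_trans nM)// ltnW.
rewrite -(subnKC nL) visits_add natrD.
have := IH (L - n)%N _ (iter n tau w) (iter_circle n Cw).
rewrite -subSn// => /(_ _); rewrite subSn// ltn_subrL n0 (leq_ltn_trans _ ML)// => /(_ isT).
have := visits_le n w (@subsetUl _ A E); lra.
Qed.

(** Integrating over the circle gives [c (L - M) <= L mu(A)] by invariance of the measure; then [L]
    tends to infinity. *)
Lemma frequency_le A (c : R) M : measurable A -> A `<=` C -> 0 <= c ->
  (forall L w, C w -> c * (L%:R - M%:R) <= visits A L w) -> (c%:E <= mu A)%E.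
Proof.
move=> mA AC c0 h.
have fA : mu A \is a fin_num.
  rewrite ge0_fin_numE//; apply: (@le_lt_trans _ _ (mu C)).
    by apply: le_measure; rewrite ?inE//; exact: measurable_circle.
  exact: circle_lty.
rewrite -(fineK fA) lee_fin; set x := fine _.
have key L : c * (L%:R - M%:R) <= L%:R * x.
  have [LM|ML] := leqP L M.
    rewrite (@le_trans _ _ 0)//; first by rewrite mulr_ge0_le0// subr_le0 ler_nat.
    by rewrite mulr_ge0// fine_ge0.
  rewrite -lee_fin [leRHS]EFinM /x fineK// -integral_visits//.
  rewrite -[leLHS]mule1 -measure_circle -integral_cst; last exact: measurable_circle.
  apply: ge0_le_integral => //.
  - exact: measurable_circle.
  - by move=> w _; rewrite /= lee_fin mulr_ge0// subr_ge0 ler_nat ltnW.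
  - apply/measurable_EFinP; apply: (@eq_measurable_fun _ _ _ _ _ (fun w => \sum_(j < L) (\1_(pre j A) w : R))).
      by move=> w /set_mem Cw; rewrite visitsE.
    by apply: measurable_sum => j; apply: measurable_indic; case: (pre_measure j mA AC).
  - by move=> w Cw; rewrite /= lee_fin h.
rewrite leNgt; apply/negP => xc.
have cx : 0 < c - x by rewrite subr_gt0.
have := archi_boundP (divr_ge0 (mulr_ge0 c0 (ler0n R M)) (ltW cx)).
set N := Num.bound _; rewrite ltr_pdivrMr// => hN.
have := key N; lra.
Qed.

Hypothesis tau_erg : ergodic tau.

(** If the bound failed on a non-null set, then by ergodicity almost every point would start a block
    on which [A] has frequency above [c]. Adjoining to [A] the small set [E M] of points without
    such a block of length at most [M] gives [c <= mu(A) + mu(E M)], and [mu(E M)] tends to 0. *)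
Theorem ergodic_visits_le A (c : R) : measurable A -> A `<=` C -> (mu A < c%:E)%E -> c <= 1 ->
  {ae mu, forall w, C w -> exists K : nat, forall n, visits A n w <= c * n%:R + K%:R}.
Proof.
move=> mA AC Ac c1.
have c0 : 0 <= c by rewrite -lee_fin (le_trans _ (ltW Ac)).
(* Unlike the set where the frequency exceeds [c] infinitely often, the set where
   [visits n - c n] is unbounded is exactly invariant. *)
pose B := [set w | C w /\ forall K : nat, exists n, c * n%:R + K%:R < visits A n w].
have BE : B = \bigcap_(K in setT) \bigcup_(n in setT) [set w | C w /\ c * n%:R + K%:R < visits A n w].
  apply/seteqP; split => w /=.
    by move=> [Cw h] K _; have [n hn] := h K; exists n.
  move=> h; split; first by have [n _ []] := h 0%N I.
  by move=> K; have [n _ [_ hn]] := h K I; exists n.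
have mB : measurable B.
  rewrite BE; apply: bigcap_measurableType => K _; apply: bigcup_measurable => n _.
  exact: measurable_visits_gt.
have BC : B `<=` C by move=> w [].
exists B; split => //; last first.
  move=> w /=; apply: contra_notP => nB Cw; apply: contrapT => nK; apply: nB; split => // K.
  apply: contrapT => nn; apply: nK; exists K => n; rewrite leNgt; apply/negP => h.
  by apply: nn; exists n.
have [|//|B1] := tau_erg.2 B mB BC.
  (* As [0 <= c <= 1], one step of [tau] changes [visits n - c n] by at most 1, which passing from
     [K] to [K.+1] absorbs. *)
  apply/seteqP; split => w [Cw].
    move=> [_ h]; split => // K; have [n] := h K.+1; rewrite -natr1 => hn.
    exists n.+1; rewrite visitsS -natr1; have /andP[+ _] := indic01 A w; lra.
  move=> h; split => //; split; first exact: tau_circle.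
  move=> K; have [[|n]] := h K.+1; rewrite -!natr1.
    by rewrite visits0 mulr0 add0r ltNge addr_ge0.
  rewrite visitsS => hn; exists n.
  have /andP[_] := indic01 A w; lra.
exfalso.
pose E M := C `\` \bigcup_(n in [set n | (0 < n <= M)%N]) [set w | C w /\ c * n%:R < visits A n w].
have mE M : measurable (E M).
  apply: measurableD; first exact: measurable_circle.
  by apply: bigcup_measurable => n _; exact: measurable_visits_gt.
have cI : (c%:E <= mu A + 0)%E.
  have cM M : (c%:E <= mu A + mu (E M))%E.
    apply: (@le_trans _ _ (mu (A `|` E M))); last by apply: measureU2; [exact: mA|exact: mE].
    apply: (@frequency_le _ c M) => //.
    - exact: measurableU.
    - by move=> w [/AC//|[]].
    - apply: visits_block => // w Cw nE; apply: contrapT => h; apply: nE; split => //.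
      move=> [n /= /andP[n0 nM] [_ hn]]; apply: h; exists n; split => //; exact: ltW.
  have mu0 : mu (\bigcap_n E n) = 0%E.
    apply: (@subset_measure0 _ _ _ mu _ (C `\` B)).
    - by apply: bigcap_measurableType => k _; exact: mE.
    - by apply: measurableD => //; exact: measurable_circle.
    - move=> w h; have [Cw _] := h 0%N I; split => // -[_ /(_ 0%N)[n]].
      rewrite addr0 => hn; have [_] := h n I; apply; exists n => //=.
      by rewrite leqnn andbT lt0n; apply: contraTneq hn => ->; rewrite visits0 mulr0 ltxx.
    - rewrite measureD; [|exact: measurable_circle|exact: mB|exact: circle_lty].
      rewrite setIidr// -[RHS](@subee _ 1%E)//.
      by congr (_ - _)%E; [exact: measure_circle|exact: B1].
  have cvE : mu \o E @ \oo --> mu (\bigcap_n E n).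
    apply: nonincreasing_cvg_mu => //.
    - apply: (@le_lt_trans _ _ (mu C)); last exact: circle_lty.
      by apply: le_measure; [rewrite inE; exact: mE|rewrite inE; exact: measurable_circle|move=> w []].
    - by apply: bigcap_measurableType => k _; exact: mE.
    - move=> m n mn; apply/subsetPset => w [Cw h]; split => // -[k /= /andP[k0 km] hk].
      by apply: h; exists k => //=; rewrite k0 (leq_trans km).
  rewrite mu0 in cvE.
  have fA : mu A \is a fin_num.
    rewrite ge0_fin_numE// (le_lt_trans (ltW Ac))// ltry//.
  have cv2 : (fun n => mu A + mu (E n))%E @ \oo --> (mu A + 0)%E.
    by apply: cvgeD => //; [rewrite fin_num_adde_defl|exact: cvg_cst].
  have := cvg_lim _ cv2 => <- //.
  apply: lime_ge; first by apply/cvg_ex; eexists; exact: cv2.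
  by near=> n; exact: cM.
by move: Ac; rewrite ltNge; rewrite adde0 in cI; rewrite cI.
Unshelve. all: by end_near. Qed.

End Ergodic.

(** * Mixing *)

Section RealLemmas.
Variable R : realType.
Implicit Types (x y m : R).

Lemma powR_expR x m1 : 0 < x -> x `^ m1 = expR (m1 * ln x).
Proof. by move=> x0; rewrite /powR gt_eqF. Qed.

(** Where [x] or [y] vanishes there is no logarithm to use: its exponent is then taken so negative
    that the weighted sum is -1. Otherwise both logarithms are raised by half of the available
    gap. *)
Lemma contracting_exponents x y m1 m2 : 0 <= x -> 0 <= y -> 0 < m1 -> 0 < m2 ->
  m1 + m2 = 1 -> x `^ m1 * y `^ m2 < 1 ->
  exists a b, [/\ x < expR a, y < expR b & m1 * a + m2 * b < 0].
Proof.
move=> x0 y0 m10 m20 m12.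
have lt_expR (t : R) : t < expR t by apply: lt_le_trans (expR_ge1Dx t); rewrite ltrDr.
move: x0 y0; rewrite !le_eqVlt => /orP[/eqP <- _ _|x0 /orP[/eqP <- _|y0]].
- exists ((- 1 - m2 * y) / m1), y; split; [exact: expR_gt0|exact: lt_expR|].
  by rewrite mulrC divfK ?gt_eqF// subrK oppr_lt0.
- exists x, ((- 1 - m1 * x) / m2); split; [exact: lt_expR|exact: expR_gt0|].
  by rewrite [m2 * _]mulrC divfK ?gt_eqF// addrC subrK oppr_lt0.
rewrite !powR_expR// -expRD expR_lt1 => h.
pose e := - (m1 * ln x + m2 * ln y) / 2.
have e0 : 0 < e by rewrite divr_gt0// oppr_gt0.
exists (ln x + e), (ln y + e); split.
- by rewrite -{1}[x]lnK ?posrE// ltr_expR ltrDl.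
- by rewrite -{1}[y]lnK ?posrE// ltr_expR ltrDl.
- have -> : m1 * (ln x + e) + m2 * (ln y + e) = (m1 * ln x + m2 * ln y) + (m1 + m2) * e by ring.
  by rewrite m12 /e; lra.
Qed.

Lemma expanding_exponents x y m1 m2 : 0 <= x -> 0 <= y -> 0 < m1 -> 0 < m2 ->
  m1 + m2 = 1 -> 1 < x `^ m1 * y `^ m2 ->
  exists a b, [/\ expR a < x, expR b < y & 0 < m1 * a + m2 * b].
Proof.
move=> + + m10 m20 m12.
rewrite !le_eqVlt => /orP[/eqP <- _|x0 /orP[/eqP <-|y0]].
- by rewrite powR0 ?gt_eqF// mul0r ltr10.
- by rewrite (@powR0 _ m2) ?gt_eqF// mulr0 ltr10.
rewrite !powR_expR// -expRD expR_gt1 => h.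
pose e := (m1 * ln x + m2 * ln y) / 2.
have e0 : 0 < e by rewrite divr_gt0.
exists (ln x - e), (ln y - e); split.
- by rewrite -{2}[x]lnK ?posrE// ltr_expR gtrBl.
- by rewrite -{2}[y]lnK ?posrE// ltr_expR gtrBl.
- have -> : m1 * (ln x - e) + m2 * (ln y - e) = (m1 * ln x + m2 * ln y) - (m1 + m2) * e by ring.
  by rewrite m12 /e; lra.
Qed.

Lemma exp_decay (t k M e : R) : 0 < t -> 0 <= M -> 0 < e ->
  exists N : nat, forall n, (N <= n)%N -> expR (k - t * n%:R) * M <= e.
Proof.
move=> t0 M0 e0; pose D := expR k * M / e.
have D0 : 0 <= D by rewrite !mulr_ge0 ?invr_ge0 ?expR_ge0// ltW.
have := archi_boundP (divr_ge0 D0 (ltW t0)); set N := Num.bound _ => hN.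
exists N => n Nn; rewrite expRD expRN.
have : D <= expR (t * n%:R).
  apply: le_trans (expR_ge1Dx _); rewrite ler_wpDl//.
  rewrite mulrC -ler_pdivrMr// (le_trans (ltW hN))// ler_nat//.
rewrite /D ler_pdivrMr// => h.
by rewrite mulrAC ler_pdivrMr ?expR_gt0// [e * _]mulrC.
Qed.

(** Since [v1 + v2 = n] and [m1 + m2 = 1], the upper bound on one count is a lower bound on the
    other, so both deviations are controlled in absolute value, whatever the signs of [a] and
    [b]. *)
Lemma frequency_estimate (m1 m2 d K1 K2 v1 v2 n a b : R) :
  m1 + m2 = 1 -> 0 <= K1 -> 0 <= K2 ->
  0 <= n -> v1 + v2 = n -> v1 <= (m1 + d) * n + K1 -> v2 <= (m2 + d) * n + K2 ->
  v1 * a + v2 * b <= (m1 * a + m2 * b + d * (`|a| + `|b|)) * n + (K1 + K2) * (`|a| + `|b|).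
Proof.
move=> m12 K10 K20 n0 vn h1 h2.
have m2E : m2 = 1 - m1 by lra.
have e1 : `|v1 - m1 * n| <= d * n + (K1 + K2).
  by rewrite m2E in h2; rewrite ler_norml; apply/andP; split; lra.
have e2 : `|v2 - m2 * n| <= d * n + (K1 + K2).
  by rewrite m2E in h2 *; rewrite ler_norml; apply/andP; split; lra.
have f1 : (v1 - m1 * n) * a <= (d * n + (K1 + K2)) * `|a|.
  by rewrite (le_trans (ler_norm _))// normrM ler_wpM2r.
have f2 : (v2 - m2 * n) * b <= (d * n + (K1 + K2)) * `|b|.
  by rewrite (le_trans (ler_norm _))// normrM ler_wpM2r.
lra.
Qed.

End RealLemmas.

(** * The cocycle on exponential sums *)

Section Mixing.
Variable R : realType.
Local Notation mu := (@lebesgue_measure R).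
Local Notation C := (circle R).
Variables (tau : R -> R) (A1 A2 : set R) (phi1 phi2 : R[i] -> R[i]).
Variable T : R -> entire R -> entire R.
Hypothesis tau_mp : measure_preserving tau.
Hypothesis disj : A1 `&` A2 = set0.
Hypothesis cover : A1 `|` A2 = C.
Hypotheses (ephi1 : is_entire phi1) (ephi2 : is_entire phi2).
Hypothesis T_A1 : forall w, A1 w -> T w = op_phiD phi1.
Hypothesis T_A2 : forall w, A2 w -> T w = op_phiD phi2.
Implicit Types (w : R) (l z : R[i]) (s t : seq (R[i] * R[i])) (n : nat).

Definition multiplier w n l : R[i] :=
  \prod_(j < n) (if iter j tau w \in A1 then phi1 l else phi2 l).

Definition scale_seq (k : R[i] -> R[i]) s := [seq (p.1 * k p.2, p.2) | p <- s].

Lemma cases_circle w : C w ->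
  (w \in A1 /\ w \notin A2) \/ (w \notin A1 /\ w \in A2).
Proof.
rewrite -cover => -[h|h]; [left|right]; split; rewrite ?notin_setE; try exact: mem_set.
  by move=> h'; rewrite -[False]/(set0 w) -disj.
by move=> h'; rewrite -[False]/(set0 w) -disj.
Qed.

Lemma cocycle_expsum w n s : C w ->
  cocycle tau T n w (expsumE s) = expsumE (scale_seq (multiplier w n) s).
Proof.
move=> Cw; elim: n => [|n IH] /=.
  congr expsumE; rewrite /scale_seq (eq_map (g := id)) ?map_id// => -[a b] /=.
  by rewrite /multiplier big_ord0 mulr1.
have Cn := iter_circle tau_mp n Cw; rewrite IH.
have H (phi : R[i] -> R[i]) : is_entire phi -> T (iter n tau w) = op_phiD phi ->
    (forall l, multiplier w n.+1 l = multiplier w n l * phi l) ->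
    T (iter n tau w) (expsumE (scale_seq (multiplier w n) s)) =
    expsumE (scale_seq (multiplier w n.+1) s).
  move=> ephi -> e; rewrite op_phiD_expsum//; congr expsumE.
  by rewrite /scale_seq -map_comp; apply: eq_map => p /=; rewrite e mulrA.
have [[h _]|[h h2]] := cases_circle Cn.
  apply: (H phi1) => //; first by apply: T_A1; exact: set_mem.
  by move=> l; rewrite /multiplier big_ord_recr /= h.
apply: (H phi2) => //; first by apply: T_A2; exact: set_mem.
by move=> l; rewrite /multiplier big_ord_recr /= (negbTE h).
Qed.

Lemma visits_total w n : C w -> visits tau A1 n w + visits tau A2 n w = n%:R.
Proof.
move=> Cw; rewrite /visits -big_split /= -[n in RHS]card_ord -sumr_const.
apply: eq_bigr => j _; rewrite !indicE.
by have [[-> /negbTE->]|[/negbTE-> ->]] := cases_circle (iter_circle tau_mp j Cw);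
  rewrite ?addr0 ?add0r.
Qed.

Lemma multiplier_le w n l (a b : R) : C w ->
  nc (phi1 l) <= expR a -> nc (phi2 l) <= expR b ->
  nc (multiplier w n l) <= expR (visits tau A1 n w * a + visits tau A2 n w * b).
Proof.
move=> Cw ha hb; elim: n => [|n IH].
  by rewrite /multiplier /visits !big_ord0 nc1 !mul0r addr0 expR0.
rewrite /multiplier /visits !big_ord_recr /= -/(multiplier w n l) ncM.
rewrite -/(visits tau A1 n w) -/(visits tau A2 n w) !mulrDl addrACA expRD.
apply: ler_pM; rewrite ?nc_ge0// !indicE.
by have [[-> /negbTE->]|[/negbTE-> ->]] := cases_circle (iter_circle tau_mp n Cw);
  rewrite ?mul1r ?mul0r ?addr0 ?add0r.
Qed.

Lemma multiplier_ge w n l (a b : R) : C w ->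
  expR a <= nc (phi1 l) -> expR b <= nc (phi2 l) ->
  expR (visits tau A1 n w * a + visits tau A2 n w * b) <= nc (multiplier w n l).
Proof.
move=> Cw ha hb; elim: n => [|n IH].
  by rewrite /multiplier /visits !big_ord0 nc1 !mul0r addr0 expR0.
rewrite /multiplier /visits !big_ord_recr /= -/(multiplier w n l) ncM.
rewrite -/(visits tau A1 n w) -/(visits tau A2 n w) !mulrDl addrACA expRD.
apply: ler_pM; rewrite ?expR_ge0// !indicE.
by have [[-> /negbTE->]|[/negbTE-> ->]] := cases_circle (iter_circle tau_mp n Cw);
  rewrite ?mul1r ?mul0r ?addr0 ?add0r.
Qed.

Lemma expsum_scale_le (k : R[i] -> R[i]) s z (r q : R) : nc z <= r ->
  (forall p, p \in s -> nc (k p.2) <= q) ->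
  nc (expsum (scale_seq k s) z) <= q * \sum_(p <- s) nc p.1 * expR (nc p.2 * r).
Proof.
move=> zr hq; rewrite /expsum big_map (le_trans (nc_sum _ _))// mulr_sumr.
rewrite [leLHS]big_seq [leRHS]big_seq; apply: ler_sum => p ps /=.
rewrite !ncM [nc p.1 * _]mulrC -mulrA; apply: ler_pM; rewrite ?mulr_ge0 ?nc_ge0 ?hq//.
by rewrite ler_wpM2l ?nc_ge0// nc_cexp_le.
Qed.

(** Nonvanishing is a separate hypothesis because [0^-1 = 0] satisfies any bound on the inverse,
    while the preimage of [v] is obtained by dividing its coefficients by the multipliers. *)
Lemma mixing_at w (z0 z1 : R[i]) (d0 d1 : R) (k t k' t' : R) : C w -> 0 < d0 -> 0 < d1 ->
  0 < t -> 0 < t' ->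
  (forall l n, nc (l - z0) < d0 -> nc (multiplier w n l) <= expR (k - t * n%:R)) ->
  (forall l n, nc (l - z1) < d1 -> nc (multiplier w n l)^-1 <= expR (k' - t' * n%:R)) ->
  (forall l n, nc (l - z1) < d1 -> multiplier w n l != 0) ->
  topologically_mixing (fun n => cocycle tau T n w).
Proof.
move=> Cw d00 d10 t0 t'0 hc he hn U V oU oV [f Uf] [g Vg].
have [r r0 hU] := open_entire_ball oU Uf; have [r' r'0 hV] := open_entire_ball oV Vg.
(* Each tolerance is shared equally between the density approximation and the term that decays with
   [n]. *)
have i2 : 0 < r^-1 / 2 by rewrite divr_gt0 ?invr_gt0.
have i2' : 0 < r'^-1 / 2 by rewrite divr_gt0 ?invr_gt0.
have ef : is_entire (entire_val f) by exact: set_mem (valP f).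
have eg : is_entire (entire_val g) by exact: set_mem (valP g).
have [s hs es] := entire_expapprox z0 ef d00 r0 i2.
have [v hv ev] := entire_expapprox z1 eg d10 r'0 i2'.
have sum0 u (q : R) : 0 <= \sum_(p <- u) nc p.1 * expR (nc (p : R[i] * R[i]).2 * q).
  by apply: sumr_ge0 => p _; rewrite mulr_ge0 ?nc_ge0 ?expR_ge0.
have [N hN] := exp_decay k t0 (sum0 s r') i2'.
have [N' hN'] := exp_decay k' t'0 (sum0 v r) i2.
exists (maxn N N') => // n /=; rewrite geq_max => /andP[Nn N'n].
pose u := s ++ scale_seq (fun l => (multiplier w n l)^-1) v.
exists (cocycle tau T n w (expsumE u)); split.
  exists (expsumE u) => //; apply: hU => z zr.
  rewrite expsumE_val /u expsum_cat opprD addrA (le_trans (ncD _ _))// ncN.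
  rewrite [leRHS]splitr lerD ?es// (le_trans _ (hN' n N'n))//.
  by apply: expsum_scale_le => // p /hv; exact: he.
rewrite cocycle_expsum//; apply: hV => z zr.
have -> : scale_seq (multiplier w n) u = scale_seq (multiplier w n) s ++ v.
  rewrite /u /scale_seq map_cat; congr (_ ++ _); rewrite -map_comp -[RHS]map_id.
  apply/eq_in_map => -[a b] /hv /= hb; congr (_, _).
  by rewrite mulfVK// hn.
rewrite expsumE_val expsum_cat opprD addrCA addrC (le_trans (ncD _ _))// ncN.
rewrite [leRHS]splitr lerD ?ev// (le_trans _ (hN n Nn))//.
by apply: expsum_scale_le => // p /hs; exact: hc.
Qed.

End Mixing.

Lemma entire_lt_near (R : realType) (phi : R[i] -> R[i]) (z : R[i]) (x : R) : is_entire phi ->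
  nc (phi z) < x -> exists2 d : R, 0 < d & forall l, nc (l - z) < d -> nc (phi l) < x.
Proof.
move=> /is_entireP/(_ z)/diffC_cont/contCP h lt; have e0 : 0 < x - nc (phi z) by rewrite subr_gt0.
have /nbhs_ncP[d d0 hd] := h _ e0; exists d => // l /hd.
have := ncDB (phi l) (phi z); lra.
Qed.

Lemma entire_gt_near (R : realType) (phi : R[i] -> R[i]) (z : R[i]) (x : R) : is_entire phi ->
  x < nc (phi z) -> exists2 d : R, 0 < d & forall l, nc (l - z) < d -> x < nc (phi l).
Proof.
move=> /is_entireP/(_ z)/diffC_cont/contCP h lt; have e0 : 0 < nc (phi z) - x by rewrite subr_gt0.
have /nbhs_ncP[d d0 hd] := h _ e0; exists d => // l /hd.
have := ncDB (phi z) (phi l); rewrite ncB; lra.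
Qed.

Theorem theorem1p4 (R : realType) (tau : R -> R) (A1 A2 : set R)
    (phi1 phi2 : R[i] -> R[i]) (T : R -> entire R -> entire R)
    (tau_ergodic : ergodic tau)
    (measurable_A1 : measurable A1) (measurable_A2 : measurable A2)
    (disjoint_A : A1 `&` A2 = set0) (cover_A : A1 `|` A2 = circle R)
    (A1_gt0 : (0 < lebesgue_measure A1)%E)
    (A2_gt0 : (0 < lebesgue_measure A2)%E)
    (phi1_entire : is_entire phi1) (phi2_entire : is_entire phi2)
    (phi1_type : exponential_type phi1) (phi2_type : exponential_type phi2)
    (phi1_nonconst : nonconstant phi1) (phi2_nonconst : nonconstant phi2)
    (T_A1 : forall w, A1 w -> T w = op_phiD phi1)
    (T_A2 : forall w, A2 w -> T w = op_phiD phi2)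
    (contracting : exists z : R[i],
      Normc.normc (phi1 z) `^ fine (lebesgue_measure A1) *
      Normc.normc (phi2 z) `^ fine (lebesgue_measure A2) < 1)
    (expanding : exists w : R[i],
      1 < Normc.normc (phi1 w) `^ fine (lebesgue_measure A1) *
          Normc.normc (phi2 w) `^ fine (lebesgue_measure A2)) :
  {ae lebesgue_measure, forall w : R, circle R w ->
    topologically_mixing (fun n => cocycle tau T n w)}.
Proof.
have A1C : A1 `<=` circle R by rewrite -cover_A; exact: subsetUl.
have A2C : A2 `<=` circle R by rewrite -cover_A; exact: subsetUr.
have fin (A : set R) : measurable A -> A `<=` circle R -> lebesgue_measure A \is a fin_num.
  move=> mA AC; rewrite ge0_fin_numE//; apply: le_lt_trans (circle_lty R).
  by apply: le_measure; [rewrite inE; exact: mA|rewrite inE; exact: measurable_circle|exact: AC].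
have f1 := fin _ measurable_A1 A1C; have f2 := fin _ measurable_A2 A2C.
set m1 := fine (lebesgue_measure A1) in contracting expanding.
set m2 := fine (lebesgue_measure A2) in contracting expanding.
have m1E : lebesgue_measure A1 = m1%:E by rewrite /m1 fineK.
have m2E : lebesgue_measure A2 = m2%:E by rewrite /m2 fineK.
have m10 : 0 < m1 by rewrite -lte_fin -m1E.
have m20 : 0 < m2 by rewrite -lte_fin -m2E.
have m12 : m1 + m2 = 1.
  apply: EFin_inj; rewrite EFinD -m1E -m2E -(measure_circle R) -cover_A; apply/esym.
  by apply: measureU.
case: contracting => z0 /(contracting_exponents (nc_ge0 _) (nc_ge0 _) m10 m20 m12)[a [b [ha hb ab]]].
case: expanding => z1 /(expanding_exponents (nc_ge0 _) (nc_ge0 _) m10 m20 m12)[a' [b' [ha' hb' ab']]].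
have [d1 d10 hd1] := entire_lt_near phi1_entire ha.
have [d2 d20 hd2] := entire_lt_near phi2_entire hb.
have [d3 d30 hd3] := entire_gt_near phi1_entire ha'.
have [d4 d40 hd4] := entire_gt_near phi2_entire hb'.
pose g := - (m1 * a + m2 * b); pose g' := m1 * a' + m2 * b'.
have g0 : 0 < g by rewrite oppr_gt0.
pose S := `|a| + `|b|; pose S' := `|a'| + `|b'|.
have S0 : 0 <= S by rewrite addr_ge0.
have S'0 : 0 <= S' by rewrite addr_ge0.
(* [e <= m1] and [e <= m2] give [m1 + e <= 1] and [m2 + e <= 1], as [ergodic_visits_le] requires;
   the other two bounds make the frequency error cost at most half of the rates [g] and [g']. *)
pose e := Num.min (Num.min m1 m2) (Num.min (g / (2 * (S + 1))) (g' / (2 * (S' + 1)))).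
have q0 : 0 < 2 * (S + 1) by rewrite mulr_gt0// ltr_wpDl.
have q'0 : 0 < 2 * (S' + 1) by rewrite mulr_gt0// ltr_wpDl.
have e0 : 0 < e by rewrite /e !lt_min m10 m20 !divr_gt0.
have : e <= e by [].
rewrite {2}/e !le_min => /andP[/andP[em1 em2] /andP[]].
rewrite ler_pdivlMr// => eS; rewrite ler_pdivlMr// => eS'.
have eS2 : e * S <= g / 2 by lra.
have eS'2 : e * S' <= g' / 2 by lra.
have ae1 : {ae lebesgue_measure, forall w, circle R w ->
    exists K : nat, forall n, visits tau A1 n w <= (m1 + e) * n%:R + K%:R}.
  apply: ergodic_visits_le => //; first exact: tau_ergodic.1.
    by rewrite m1E lte_fin ltrDl.
  by rewrite -m12 lerD2l.
have ae2 : {ae lebesgue_measure, forall w, circle R w ->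
    exists K : nat, forall n, visits tau A2 n w <= (m2 + e) * n%:R + K%:R}.
  apply: ergodic_visits_le => //; first exact: tau_ergodic.1.
    by rewrite m2E lte_fin ltrDl.
  by rewrite -m12 addrC lerD2r.
apply: (@filterS2 _ _ (ae_filter_ringOfSetsType _) _ _ _ _ ae1 ae2) => w h1 h2 Cw.
have [K1 hK1] := h1 Cw; have [K2 hK2] := h2 Cw.
have tau_mp := tau_ergodic.1.
have vt n := visits_total tau_mp disjoint_A cover_A n Cw.
have est (x y : R) n := frequency_estimate x y m12 (ler0n R K1) (ler0n R K2) (ler0n R n)
  (vt n) (hK1 n) (hK2 n).
pose k := (K1%:R + K2%:R) * S; pose k' := (K1%:R + K2%:R) * S'.
have low n : visits tau A1 n w * a + visits tau A2 n w * b <= k - g / 2 * n%:R.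
  apply: le_trans (est a b n) _; rewrite -/S -/k addrC lerD2l -mulNr ler_wpM2r//.
  by rewrite -[m1 * a + _]opprK -/g; lra.
(* The lower bound on the growth is the same upper estimate, taken at the opposite exponents. *)
have upp n : - (visits tau A1 n w * a' + visits tau A2 n w * b') <= k' - g' / 2 * n%:R.
  have := est (- a') (- b') n; rewrite !normrN -/S' -/k' !mulrN -!opprD -/g' => /le_trans; apply.
  by rewrite addrC lerD2l -mulNr ler_wpM2r//; lra.
apply: (@mixing_at _ _ _ _ _ _ _ tau_mp disjoint_A cover_A phi1_entire phi2_entire T_A1 T_A2
  w z0 z1 (Num.min d1 d2) (Num.min d3 d4) k (g / 2) k' (g' / 2)) => //.
- by rewrite lt_min d10.
- by rewrite lt_min d30.
- by rewrite divr_gt0.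
- by rewrite divr_gt0.
- move=> l n; rewrite lt_min => /andP[/hd1/ltW l1 /hd2/ltW l2].
  apply: le_trans (multiplier_le tau_mp disjoint_A cover_A n Cw l1 l2) _.
  by rewrite ler_expR.
- move=> l n; rewrite lt_min => /andP[/hd3/ltW l1 /hd4/ltW l2].
  have := multiplier_ge tau_mp disjoint_A cover_A n Cw l1 l2.
  set v := _ + _ => hv; rewrite ncV.
  apply: (@le_trans _ _ (expR (- v))); last by rewrite ler_expR upp.
  by rewrite expRN lef_pV2 ?posrE ?expR_gt0 ?(lt_le_trans (expR_gt0 _) hv).
- move=> l n; rewrite lt_min => /andP[/hd3/ltW l1 /hd4/ltW l2].
  have := multiplier_ge tau_mp disjoint_A cover_A n Cw l1 l2.
  by rewrite -nc_gt0; apply: lt_le_trans; exact: expR_gt0.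
Qed.
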